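(* Let $q\in[-1,1]$ and $s\ge1$. For each $N$ let $$\mathbf W_1^{(N)},\dots,\mathbf W_s^{(N)},\widetilde{\mathbf W}_1^{(N)},\dots,\widetilde{\mathbf W}_s^{(N)}\in\mathcal W_q\left(\tfrac1N I_N,I_M\right)$$ be $q$-orthogonal, with $M=M(N)$ such that $M/N\to\lambda\in[0,\infty)$ as $N\to\infty$. Fix a polynomial $Q(x_1,\dots,x_s)$ in noncommutative variables and let $$X_N=\mathrm{tr}(Q(\mathbf W_1^{(N)},\dots,\mathbf W_s^{(N)}))-\tau\big(\mathrm{tr}(Q(\mathbf W_1^{(N)},\dots,\mathbf W_s^{(N)}))\big),$$ $$Y_N=\mathrm{tr}(Q(\widetilde{\mathbf W}_1^{(N)},\dots,\widetilde{\mathbf W}_s^{(N)}))-\tau\big(\mathrm{tr}(Q(\widetilde{\mathbf W}_1^{(N)},\dots,\widetilde{\mathbf W}_s^{(N)}))\big).$$ Then for every integer $m\ge0$ the limits $\lim_{N\to\infty}\tau(X_N^2)$ and $\lim_{N\to\infty}\tau\big((X_N+Y_N)^m\big)$ exist, and $$\lim_{N\to\infty}\Big(\tau\big((X_N-Y_N)^2(X_N+Y_N)^m\big)-2\,\tau(X_N^2)\,\tau\big((X_N+Y_N)^m\big)\Big)=0.$$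
   Context: A noncommutative probability space is a unital complex $*$-algebra $\mathcal A$ with a tracial state $\tau:\mathcal A\to\mathbb C$ (it may depend on $N$). Fix $q\in[-1,1]$. Elements $\mathbf X_1,\mathbf X_2,\dots\in\mathcal A$ are (jointly) $q$-Gaussian if $\mathbf X_j=\mathbf X_j^*$ and for any $\mathbf Y_1,\dots,\mathbf Y_n\in\{\mathbf X_1,\mathbf X_2,\dots\}$, $$\tau(\mathbf Y_1\cdots\mathbf Y_n)=\sum_{\mathcal V}q^{\mathrm{cr}(\mathcal V)}\prod_{\{i,j\}\in\mathcal V,\ i<j}\tau(\mathbf Y_i\mathbf Y_j),$$ where the sum is over all pair partitions $\mathcal V$ of $\{1,\dots,n\}$ (so it is $0$ for odd $n$), $\mathrm{cr}(\mathcal V)=\#\{(i_1,i_2):\{i_1,j_1\},\{i_2,j_2\}\in\mathcal V,\ i_1<i_2<j_1<j_2\}$, and $0^0=1$. For real positive definite matrices $\Sigma$ ($N\times N$) and $B$ ($M\times M$), $\mathbf W\in\mathcal W_q(\Sigma,B)$ means that $\mathbf W=\mathbf X^*\mathbf X$ is the $N\times N$ matrix over $\mathcal A$ obtained from an $M\times N$ matrix $\mathbf X=[\mathbf X_{i,j}]$ of jointly $q$-Gaussian elements of $\mathcal A$ with $\tau(\mathbf X_{i,j}\mathbf X_{k,m})=[B]_{i,k}[\Sigma]_{j,m}$; here $*$ on matrices is transposition combined with entrywise $*$. Thus $[\mathbf W]_{i,j}=\sum_k\mathbf X_{k,i}\mathbf X_{k,j}$. A finite family of matrices in $\mathcal W_q(\Sigma,B)$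 is $q$-orthogonal if the entries of all the corresponding matrices $\mathbf X^{(1)},\mathbf X^{(2)},\dots$ are jointly $q$-Gaussian with $\tau(\mathbf X^{(k)}_{i,j}\mathbf X^{(k')}_{i',j'})=[B]_{i,i'}[\Sigma]_{j,j'}\delta_{k,k'}$. $\mathrm{tr}$ is the unnormalized trace, $\mathrm{tr}(\mathbf Z)=\sum_{i=1}^N[\mathbf Z]_{i,i}\in\mathcal A$. The numbers $\tau(\cdot)$ subtracted in $X_N,Y_N$ are understood as multiples of the unit of $\mathcal A$. *)

(* Defs.v *)
From HB Require Import structures.
From mathcomp Require Import all_boot all_order all_algebra.
From mathcomp Require Import finmap complex.
From mathcomp Require Import all_classical all_reals all_analysis.
From mathcomp.multinomials Require Import -(notations) monalg.
Import numFieldNormedType.Exports.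
Import Order.TTheory GRing.Theory Num.Theory.

Set Implicit Arguments.
Unset Strict Implicit.
Unset Printing Implicit Defensive.

Local Open Scope ring_scope.
Local Open Scope complex_scope.

(* [0 <= z] in [R[i]] means that [z] is real and nonnegative, so [nc_tau_ge0]
   is positivity of the state; [algType] is always unital. *)
Record ncProbSpace (R : realType) := NCProbSpace {
  nc_alg :> algType R[i];
  nc_star : nc_alg -> nc_alg;
  nc_starK : involutive nc_star;
  nc_starD : forall a b, nc_star (a + b) = nc_star a + nc_star b;
  nc_starZ : forall (c : R[i]) a, nc_star (c *: a) = c^* *: nc_star a;
  nc_starM : forall a b, nc_star (a * b) = nc_star b * nc_star a;
  nc_tau : {scalar nc_alg};
  nc_tau1 : nc_tau 1 = 1;
  nc_tau_ge0 : forall a, 0 <= nc_tau (nc_star a * a);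
  nc_tau_tracial : forall a b, nc_tau (a * b) = nc_tau (b * a)
}.

Definition pair_partition n (V : {set {set 'I_n}}) : bool :=
  finset.partition V [set: 'I_n] && [forall B in V, (#|B| == 2)%N].

Definition crossings n (V : {set {set 'I_n}}) : nat :=
  #|[set p : 'I_n * 'I_n | [exists j1, exists j2,
      [&& [set p.1; j1] \in V, [set p.2; j2] \in V,
          p.1 < p.2, p.2 < j1 & j1 < j2]]]|%N.

Definition jointly_qgaussian (R : realType) (A : ncProbSpace R) (q : R)
    (I : Type) (X : I -> A) : Prop :=
  (forall i, nc_star (X i) = X i) /\
  forall (n : nat) (y : 'I_n -> I),
    nc_tau A (\prod_(k < n) X (y k)) =
    \sum_(V : {set {set 'I_n}} | pair_partition V)
      q%:C ^+ crossings V *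
      \prod_(p : 'I_n * 'I_n | (p.1 < p.2)%N && ([set p.1; p.2] \in V))
        nc_tau A (X (y p.1) * X (y p.2)).

Definition adjmx (R : realType) (A : ncProbSpace R) m n (X : 'M[A]_(m, n)) :
    'M[A]_(n, m) :=
  map_mx (@nc_star R A) X^T.

(* [W] is a [q]-orthogonal family in W_q(Sigma, B): a single family [X] of
   matrices both realizes every [W k] as [X k]^* [X k] and has all its entries
   jointly [q]-Gaussian with the prescribed covariance. *)
Definition qwishart_orthogonal (R : realType) (A : ncProbSpace R) (q : R)
    (N M : nat) (Sigma : 'M[R]_N) (B : 'M[R]_M)
    (I : finType) (W : I -> 'M[A]_N) : Prop :=
  exists X : I -> 'M[A]_(M, N),
    [/\ jointly_qgaussian q (fun e : I * 'I_M * 'I_N => X e.1.1 e.1.2 e.2),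
        forall k k' i i' j j',
          nc_tau A (X k i j * X k' i' j') =
          (B i i' * Sigma j j' * (k == k')%:R)%:C
      & forall k, W k = adjmx (X k) *m X k].

(* Polynomials in [s] noncommutative variables: the monoid algebra over the
   complex numbers of the free monoid on ['I_s]. *)
Definition ncpoly (R : realType) (s : nat) := malg (fmonom 'I_s) R[i].

Definition ncpoly_eval (R : realType) (s : nat) (A : ncProbSpace R) (N : nat)
    (Q : ncpoly R s) (W : 'I_s -> 'M[A]_N) : 'M[A]_N :=
  \sum_(w <- msupp Q)
    ((mcoeff w Q)%:A)%:M *m \big[mulmx/1%:M]_(k <- fmonom_val w) W k.

Definition centered_trace (R : realType) (s : nat) (A : ncProbSpace R)
    (N : nat) (Q : ncpoly R s) (W : 'I_s -> 'M[A]_N) : A :=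
  \tr (ncpoly_eval Q W) - (nc_tau A (\tr (ncpoly_eval Q W)))%:A.

Definition sum_family (I J T : Type) (f : I -> T) (g : J -> T) (k : I + J) :=
  match k with inl i => f i | inr j => g j end.

(* Main.v *)
Require Import Defs.
From HB Require Import structures.
From mathcomp Require Import all_boot all_order all_algebra.
From mathcomp Require Import finmap complex.
From mathcomp Require Import all_classical all_reals all_analysis.
From mathcomp.multinomials Require Import -(notations) monalg.
From mathcomp Require Import zify ring mxabelem.
From mathcomp Require Import fintype finset.
Import numFieldNormedType.Exports.
Import Order.TTheory GRing.Theory Num.Theory.

Set Implicit Arguments.
Unset Strict Implicit.
Unset Printing Implicit Defensive.

Local Open Scope ring_scope.
Local Open Scope complex_scope.

(** Expand the traces into words in the entries of the Gaussian matrices.  A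
    mixed moment of q-Gaussian elements is a sum over pairings V of the letters.
    Each word occupies an interval of positions, so if V pairs the letters of
    one word among themselves then no other pair crosses them and the weight of
    V factors.  Centering the words therefore removes exactly the pairings that
    isolate a word (tau_cwords), and centering a product of words removes those
    that isolate the product (tau_cwords2).

    Fix such a pairing V of 2n positions spread over k cyclic words, and sum over
    the matrix indices.  The covariances force row indices, and column indices,
    to agree along the pairs, so V contributes
      q ^ crossings * N^-n * M^b * N^f,
    where b and f count the classes of row and of column indices
    (tau_prod_ctrace).  This is a surface glued from n edges, with b + f vertices
    and k faces, so b + f - n + k <= 2 c with c the number of its components
    (euler_bound).  When no word is isolated every component contains at least
    two words, so 2 c <= k and b + f <= n; the contribution converges, because
    M / N does, and it tends to 0 as soon as a component contains three words.
    This gives the existence of all limits.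

    The same expansion treats X - Y and X + Y.  Every word carries a choice
    between the two q-orthogonal families, and a pairing contributes only if that
    choice is constant on its components.  By tau((X - Y)^2) = 2 tau(X^2), the
    difference to be estimated is the moment of
      ((X - Y)^2 - tau((X - Y)^2)) (X + Y)^m.
    Only pairings which isolate neither a word nor the union of the first two
    words enter (tau_centered_comb).  If the first two words lie in different
    components, exchanging the two families along the component of the first
    word changes the sign and the contributions cancel (copy_sum_unlinked).  If
    they lie in the same component, that component contains a third word, and
    the contribution tends to 0. *)

(** * Pairings and their restriction to sets of positions *)
Section Pairings.
Variable T : finType.
Implicit Types (S : {set T}) (V : {set {set T}}) (B : {set T}).

Definition pairing S V : bool :=
  partition V S && [forall B in V, (#|B| == 2)%N].

(** No pair joins S to its complement; when S is an interval, the weight of V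
    then splits along S. *)
Definition preserved S V : bool :=
  [forall B in V, (B \subset S) || [disjoint B & S]].

Definition restr S V : {set {set T}} := [set B in V | B \subset S].

Lemma pairing_set2 S V B : pairing S V -> B \in V ->
  exists x y, x != y /\ B = [set x; y].
Proof.
move=> /andP[_ /forall_inP c2] /c2 /cards2P[x [y [xy ->]]].
by exists x, y.
Qed.

Lemma pairing_mem S V B : pairing S V -> B \in V -> B \subset S.
Proof. by move=> /andP[pV _]; apply: partitionS. Qed.

Lemma pairing_neq S V x y : pairing S V -> [set x; y] \in V -> x != y.
Proof.
move=> /andP[_ /forall_inP c2] /c2; rewrite cards2.
by case: (x == y).
Qed.

Lemma pairingU S1 S2 V1 V2 : [disjoint S1 & S2] ->
  pairing S1 V1 -> pairing S2 V2 -> pairing (S1 :|: S2) (V1 :|: V2).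
Proof.
move=> dS p1 p2.
have /andP[/and3P[/eqP c1 t1 n1] /forall_inP s1] := p1.
have /andP[/and3P[/eqP c2 t2 n2] /forall_inP s2] := p2.
apply/andP; split; last first.
  by apply/forall_inP => B; rewrite inE => /orP[/s1|/s2].
apply/and3P; split.
- by rewrite -c1 -c2 /cover bigcup_setU.
- apply/trivIsetP => A B; rewrite !inE => /orP[] hA /orP[] hB AB.
  + exact: (trivIsetP t1).
  + apply: disjointWl (pairing_mem p1 hA) _.
    by apply: disjointWr (pairing_mem p2 hB) _.
  + rewrite disjoint_sym; apply: disjointWl (pairing_mem p1 hB) _.
    by apply: disjointWr (pairing_mem p2 hA) _.
  + exact: (trivIsetP t2).
- by rewrite inE negb_or n1.
Qed.

Lemma restrU S1 S2 V1 V2 : [disjoint S1 & S2] ->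
  pairing S1 V1 -> pairing S2 V2 ->
  restr S1 (V1 :|: V2) = V1 /\ restr S2 (V1 :|: V2) = V2.
Proof.
move=> dS p1 p2; split; apply/setP => B; rewrite !inE.
- have [BV1|_] := boolP (B \in V1); first by rewrite (pairing_mem p1 BV1).
  apply/negbTE/negP => /andP[BV2 sB].
  have [x [y [_ eB]]] := pairing_set2 p2 BV2.
  have xB : x \in B by rewrite eB !inE eqxx.
  have := disjointFr dS (subsetP sB _ xB).
  by rewrite (subsetP (pairing_mem p2 BV2) _ xB).
- have [BV2|_] := boolP (B \in V2).
    by rewrite orbT (pairing_mem p2 BV2).
  rewrite orbF; apply/negbTE/negP => /andP[BV1 sB].
  have [x [y [_ eB]]] := pairing_set2 p1 BV1.
  have xB : x \in B by rewrite eB !inE eqxx.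
  have := disjointFl dS (subsetP sB _ xB).
  by rewrite (subsetP (pairing_mem p1 BV1) _ xB).
Qed.

Lemma preservedU S1 S2 V1 V2 : [disjoint S1 & S2] ->
  pairing S1 V1 -> pairing S2 V2 -> preserved S1 (V1 :|: V2).
Proof.
move=> dS p1 p2; apply/forall_inP => B; rewrite inE => /orP[] hB.
  by rewrite (pairing_mem p1 hB).
apply/orP; right; rewrite disjoint_sym.
by apply: disjointWr (pairing_mem p2 hB) _.
Qed.

Lemma preserved_restr S1 S2 V : [disjoint S1 & S2] ->
  pairing (S1 :|: S2) V -> preserved S1 V ->
  [/\ pairing S1 (restr S1 V), pairing S2 (restr S2 V)
    & restr S1 V :|: restr S2 V = V].
Proof.
move=> dS pV /forall_inP prV.
have /andP[/and3P[/eqP cV tV nV] /forall_inP sV] := pV.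
have sub12 B : B \in V -> ~~ (B \subset S1) -> B \subset S2.
  move=> BV nB; have := prV _ BV; rewrite (negbTE nB) /= => dB.
  apply/subsetP => x xB; have := subsetP (pairing_mem pV BV) _ xB.
  by rewrite inE (disjointFr dB xB).
have tr S : trivIset (restr S V).
  by apply: trivIsetS tV; apply/subsetP => B; rewrite inE => /andP[].
split.
- apply/andP; split; last first.
    by apply/forall_inP => B; rewrite inE => /andP[/sV].
  apply/and3P; split=> //; last by rewrite inE (negbTE nV).
  rewrite eqEsubset; apply/andP; split.
    by apply/bigcupsP => B; rewrite inE => /andP[].
  apply/subsetP => x xS; have : x \in S1 :|: S2 by rewrite inE xS.
  rewrite -cV => /bigcupP[B BV xB]; apply/bigcupP; exists B => //.
  rewrite inE BV; case/orP: (prV _ BV) => // dB.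
  by rewrite (disjointFr dB xB) in xS.
- apply/andP; split; last first.
    by apply/forall_inP => B; rewrite inE => /andP[/sV].
  apply/and3P; split=> //; last by rewrite inE (negbTE nV).
  rewrite eqEsubset; apply/andP; split.
    by apply/bigcupsP => B; rewrite inE => /andP[].
  apply/subsetP => x xS; have : x \in S1 :|: S2 by rewrite inE xS orbT.
  rewrite -cV => /bigcupP[B BV xB]; apply/bigcupP; exists B => //.
  rewrite inE BV /=; apply: sub12 => //; apply/negP => /subsetP /(_ _ xB) xS1.
  by rewrite (disjointFr dS xS1) in xS.
- apply/setP => B; rewrite !inE -andb_orr.
  have [BV|] := boolP (B \in V) => //=.
  have [//|/sub12] := boolP (B \subset S1); exact.
Qed.

Lemma preserved_compl S1 S2 V : [disjoint S1 & S2] ->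
  pairing (S1 :|: S2) V -> preserved S1 V -> preserved S2 V.
Proof.
move=> dS pV prV; have [p1 p2 <-] := preserved_restr dS pV prV.
by rewrite setUC; apply: (@preservedU S2 S1); rewrite // disjoint_sym.
Qed.

(** A pair of V not inside S2 lies inside S1, hence is disjoint from S: whether
    S is preserved is decided by the restriction to S2. *)
Lemma preserved_restrE S1 S2 S V : [disjoint S1 & S2] ->
  pairing (S1 :|: S2) V -> preserved S1 V -> S \subset S2 ->
  preserved S (restr S2 V) = preserved S V.
Proof.
move=> dS pV prV sS; have [p1 p2 eV] := preserved_restr dS pV prV.
apply/forall_inP/forall_inP => h B; last first.
  by rewrite inE => /andP[BV _]; apply: h.
rewrite -{1}eV inE => /orP[BV|]; last exact: h.
apply/orP; right; apply: disjointWl (pairing_mem p1 BV) _.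
exact: disjointWr sS dS.
Qed.

Variables (r : T -> nat) (K : comPzRingType) (q : K) (cov : T -> T -> K).

(** The order of positions is given by a rank function, so that pairings of all
    subsets of T live in one type and can be united and restricted without
    renumbering. *)
Definition crossing_count V : nat :=
  #|[set p : T * T | [exists j1, exists j2,
      [&& [set p.1; j1] \in V, [set p.2; j2] \in V,
          (r p.1 < r p.2)%N, (r p.2 < r j1)%N & (r j1 < r j2)%N]]]|%N.

Definition pair_weight V : K :=
  \prod_(p : T * T | (r p.1 < r p.2)%N && ([set p.1; p.2] \in V)) cov p.1 p.2.

Definition pairing_weight V : K := q ^+ crossing_count V * pair_weight V.

(** S1 is an interval in the union of S1 and S2; then no pair inside S1 crosses
    a pair inside S2. *)
Definition convex_in S1 S2 : Prop := forall x y z,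
  x \in S1 -> y \in S2 -> z \in S1 -> (r x < r y)%N -> (r y < r z)%N -> False.

Lemma set2_mem S V x y : pairing S V -> [set x; y] \in V -> x \in S /\ y \in S.
Proof.
move=> pV /(pairing_mem pV) /subsetP s; split; apply: s;
by rewrite !inE eqxx ?orbT.
Qed.

Lemma crossing_countU S1 S2 V1 V2 : [disjoint S1 & S2] -> convex_in S1 S2 ->
  pairing S1 V1 -> pairing S2 V2 ->
  crossing_count (V1 :|: V2) = (crossing_count V1 + crossing_count V2)%N.
Proof.
move=> dS cS p1 p2; rewrite /crossing_count -cardsUI.
set A1 := [set p | _] => /=; set A2 := [set p | _]; set A3 := [set p | _].
have -> : A2 :&: A3 = set0.
  apply/setP => p; rewrite !inE; apply/negbTE/negP => /andP[].
  move=> /existsP[j1 /existsP[j2 /and5P[h1 _ _ _ _]]].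
  move=> /existsP[k1 /existsP[k2 /and5P[h3 _ _ _ _]]].
  have [a _] := set2_mem p1 h1; have [b _] := set2_mem p2 h3.
  by have := disjointFr dS a; rewrite b.
rewrite cards0 addn0; congr #|pred_of_set _|.
apply/setP => p; rewrite !inE; apply/idP/idP.
- move=> /existsP[j1 /existsP[j2 /and5P[]]].
  rewrite !inE => /orP[] h1 /orP[] h2 l1 l2 l3.
  + apply/orP; left; apply/existsP; exists j1; apply/existsP; exists j2.
    by rewrite h1 h2 l1 l2.
  + have [a b] := set2_mem p1 h1; have [c d] := set2_mem p2 h2.
    by have := cS _ _ _ a c b l1 l2.
  + have [a b] := set2_mem p2 h1; have [c d] := set2_mem p1 h2.
    by have := cS _ _ _ c b d l2 l3.
  + apply/orP; right; apply/existsP; exists j1; apply/existsP; exists j2.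
    by rewrite h1 h2 l1 l2.
- by move=> /orP[] /existsP[j1 /existsP[j2 /and5P[h1 h2 l1 l2 l3]]];
    apply/existsP; exists j1; apply/existsP; exists j2;
    rewrite !inE h1 h2 l1 l2 l3 ?orbT.
Qed.

Lemma pair_weightU S1 S2 V1 V2 : [disjoint S1 & S2] ->
  pairing S1 V1 -> pairing S2 V2 ->
  pair_weight (V1 :|: V2) = pair_weight V1 * pair_weight V2.
Proof.
move=> dS p1 p2; rewrite /pair_weight (bigID (fun p : T * T => p.1 \in S1)) /=.
congr (_ * _); apply: eq_bigl => p; rewrite inE.
- apply/idP/idP => [/andP[/andP[-> /orP[//|h]] a]|/andP[-> h]] /=.
    by have [b _] := set2_mem p2 h; have := disjointFr dS a; rewrite b.
  by rewrite h; have [-> _] := set2_mem p1 h.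
- apply/idP/idP => [/andP[/andP[-> /orP[h|//]] a]|/andP[-> h]] /=.
    by have [b _] := set2_mem p1 h; rewrite b in a.
  rewrite h orbT /=; have [b _] := set2_mem p2 h.
  by rewrite (disjointFl dS b).
Qed.

(** The pairings preserving an interval are the unions of a pairing of the
    interval and one of the remaining positions, and crossings occur only within
    the two parts. *)
Lemma sum_pairing_weight_factor S1 S2 (P1 P2 : pred {set {set T}}) :
  [disjoint S1 & S2] -> convex_in S1 S2 ->
  \sum_(V | [&& pairing (S1 :|: S2) V, preserved S1 V,
             P1 (restr S1 V) & P2 (restr S2 V)]) pairing_weight V =
  (\sum_(V | pairing S1 V && P1 V) pairing_weight V) *
  (\sum_(V | pairing S2 V && P2 V) pairing_weight V).
Proof.
move=> dS cS; rewrite big_distrlr /= pair_big /=; apply/esym.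
rewrite (reindex_onto (fun V => (restr S1 V, restr S2 V))
                      (fun p => p.1 :|: p.2)); last first.
  move=> [V1 V2] /= /andP[/andP[p1 _] /andP[p2 _]].
  by have [-> ->] := restrU dS p1 p2.
apply: eq_big => V /=.
  apply/idP/idP.
    move=> /andP[/andP[/andP[p1 ->] /andP[p2 ->]] /eqP eV].
    by rewrite -{1 2}eV (pairingU dS p1 p2) (preservedU dS p1 p2).
  move=> /and4P[pV prV -> ->].
  by have [-> -> ->] := preserved_restr dS pV prV; rewrite eqxx.
move=> /andP[/andP[/andP[p1 _] /andP[p2 _]] /eqP eV].
rewrite -{3}eV /pairing_weight (crossing_countU dS cS p1 p2) (pair_weightU dS p1 p2) exprD.
by rewrite mulrACA.
Qed.

End Pairings.

(** * Transporting pairings along an injection *)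
Section Transfer.
Variables (T U : finType) (h : U -> T) (hI : injective h).

Definition push (V : {set {set U}}) : {set {set T}} :=
  [set h @: (B : {set U}) | B in V].

Definition pull (V : {set {set T}}) : {set {set U}} :=
  [set h @^-1: (B : {set T}) | B in V].

Lemma mem_push2 V a b : ([set h a; h b] \in push V) = ([set a; b] \in V).
Proof. by rewrite -!imset_set1 -imsetU mem_imset //; exact: imset_inj. Qed.

Lemma pushK : cancel push pull.
Proof.
move=> V; rewrite /pull /push -imset_comp -[RHS]imset_id; apply: eq_imset => B /=.
by apply/setP => x; rewrite inE mem_imset.
Qed.

Lemma pullK (S : {set T}) V : S \subset h @: setT -> pairing S V -> push (pull V) = V.
Proof.
move=> sS pV; rewrite /pull /push -imset_comp -[RHS]imset_id.
apply: eq_in_imset => B /= BV; apply/setP => x; apply/imsetP/idP.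
  by move=> [y]; rewrite inE => ? ->.
move=> xB; have /imsetP[y _ e] := subsetP sS _ (subsetP (pairing_mem pV BV) _ xB).
by exists y; rewrite ?inE -?e.
Qed.

Lemma pairing_push (D : {set U}) V : pairing (h @: D) (push V) = pairing D V.
Proof.
rewrite /pairing (imset_partition _ _ hI).
apply: andb_id2l => _; apply/forall_inP/forall_inP => c B.
  by move=> BV; rewrite -(card_imset _ hI) c ?imset_f.
by move=> /imsetP[B' BV ->]; rewrite card_imset // c.
Qed.

Variables (r : T -> nat) (K : comPzRingType) (q : K) (cov : T -> T -> K).

Lemma push_set2 V x y : [set x; y] \in push V ->
  exists a b, [/\ x = h a, y = h b & [set a; b] \in V].
Proof.
move=> hV; have : [set x; y] \subset h @: setT.
  by move: hV => /imsetP[B _ ->]; rewrite imsetS // subsetT.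
move=> /subsetP s; have /imsetP[a _ ea] : x \in h @: setT.
  by apply: s; rewrite !inE eqxx.
have /imsetP[b _ eb] : y \in h @: setT by apply: s; rewrite !inE eqxx orbT.
by exists a, b; rewrite -mem_push2 -ea -eb.
Qed.

Lemma pairing_weight_push V :
  pairing_weight r q cov (push V) = pairing_weight (r \o h) q (fun a b => cov (h a) (h b)) V.
Proof.
have h2I : injective (fun p : U * U => (h p.1, h p.2)).
  by move=> [a b] [c d] /= [/hI -> /hI ->].
rewrite /pairing_weight; congr (_ ^+ _ * _).
  rewrite /crossing_count -(card_imset _ h2I); congr #|pred_of_set _|.
  apply/setP => p; rewrite !inE; apply/existsP/imsetP.
    move=> [j1 /existsP[j2 /and5P[]]].
    move=> /push_set2[a [b [e1 e2 h1]]] /push_set2[c [d [e3 e4 h2]]] l1 l2 l3.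
    exists (a, c); last by rewrite /= -e1 -e3; case: (p).
    rewrite inE; apply/existsP; exists b; apply/existsP; exists d.
    by rewrite h1 h2 /= -e1 -e2 -e3 -e4 l1 l2 l3.
  move=> [[a c]]; rewrite inE => /existsP[b /existsP[d /= /and5P[h1 h2 l1 l2 l3]]].
  move=> ->; exists (h b); apply/existsP; exists (h d).
  by rewrite !mem_push2 h1 h2 l1 l2 l3.
rewrite /pair_weight.
rewrite -[RHS](big_imset (fun p => cov p.1 p.2) (in2W h2I)) /=.
apply: eq_bigl => p; apply/andP/imsetP.
  move=> [l /push_set2[a [b [e1 e2 h1]]]]; exists (a, b).
    by rewrite unfold_in /= -e1 -e2 l.
  by rewrite /= -e1 -e2; case: (p).
by move=> [[a b] /andP[l h1] ->]; split; [exact: l | exact: (etrans (mem_push2 V a b) h1)].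
Qed.

End Transfer.

(** * Mixed moments of centered words *)
Section Moments.
Variables (R : realType) (A : ncProbSpace R) (q : R) (I : Type) (X : I -> A).
Hypothesis XG : jointly_qgaussian q X.
Variables (T : finType) (r : T -> nat) (y : T -> I).

Local Notation tau := (nc_tau A).

Definition cov_of (a b : T) : R[i] := tau (X (y a) * X (y b)).

Local Notation W := (pairing_weight r q%:C cov_of).

Definition word (s : seq T) : A := \prod_(t <- s) X (y t).

Definition increasing (s : seq T) : bool :=
  pairwise (fun a b => (r a < r b)%N) s.

(** The q-Gaussian formula is indexed by the ordinals below the length of the
    word; listing the positions in increasing order transports it to pairings
    of the set of positions. *)
Lemma tau_word s : increasing s ->
  tau (word s) = \sum_(V | pairing [set t in s] V) W V.
Proof.
move=> ps; have us : uniq s.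
  by apply: pairwise_uniq ps => x; rewrite ltnn.
have : injective (tnth (in_tuple s)) by apply/tuple_uniqP.
set h := tnth _ => hI.
have hr (a b : 'I_(size s)) : (r (h a) < r (h b))%N = (a < b)%N.
  have x0 : T by exact: (h a).
  have hm (c d : 'I_(size s)) : (c < d)%N -> (r (h c) < r (h d))%N.
    move=> cd; rewrite /h !(tnth_nth x0) /=.
    by move/(pairwiseP x0): ps; apply => //; rewrite inE.
  case: (ltngtP a b) => [/hm -> //|/hm|/val_inj ->]; last by rewrite ltnn.
  by move=> l; rewrite ltnNge (ltnW l).
rewrite /word big_tnth (XG.2 _ (fun i => y (h i))).
have -> : [set t in s] = h @: setT.
  apply/setP => x; rewrite inE; apply/idP/imsetP.
    by move=> /seq_tnthP[i ->]; exists i.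
  by move=> [i _ ->]; apply: (mem_tnth i (in_tuple s)).
rewrite [RHS](reindex_onto (push h) (pull h)); last first.
  by move=> V; apply: pullK.
apply: eq_big => V.
  by rewrite pairing_push // pushK // eqxx andbT.
move=> _; rewrite pairing_weight_push // /pairing_weight /crossing_count /pair_weight /=.
congr (_ ^+ _ * _); last by apply: eq_bigl => p; rewrite hr.
apply: eq_card => p; rewrite !inE.
apply: eq_existsb => j1; apply: eq_existsb => j2.
by rewrite !hr.
Qed.

Definition cword s : A := word s - (tau (word s))%:A.

Section Blocks.
Variables (J : eqType) (b : J -> seq T).

Definition support_of (js : seq J) : {set T} :=
  [set t in flatten [seq b j | j <- js]].

Definition no_isolated_word (js : seq J) (V : {set {set T}}) : bool :=
  all (fun j => ~~ preserved [set t in b j] V) js.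

Definition words_increasing (js : seq J) : bool :=
  increasing (flatten [seq b j | j <- js]).

Lemma support_cat js1 js2 :
  support_of (js1 ++ js2) = support_of js1 :|: support_of js2.
Proof. by apply/setP => t; rewrite !inE map_cat flatten_cat mem_cat. Qed.

Lemma support1 j : support_of [:: j] = [set t in b j].
Proof. by rewrite /support_of /= cats0. Qed.

Lemma support_sub j js : j \in js -> [set t in b j] \subset support_of js.
Proof.
move=> jj; apply/subsetP => t; rewrite !inE => tj.
by apply/flattenP; exists (b j) => //; apply: map_f.
Qed.

Lemma words_increasing_split js1 js2 js3 :
  words_increasing (js1 ++ js2 ++ js3) ->
  [/\ words_increasing js2, words_increasing (js1 ++ js3),
      [disjoint support_of js2 & support_of (js1 ++ js3)]
    & convex_in r (support_of js2) (support_of (js1 ++ js3))].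
Proof.
rewrite /words_increasing /increasing !map_cat !flatten_cat.
rewrite !pairwise_cat allrel_catr -!andbA.
move=> /and5P[/allrelP a12 a13 p1 /allrelP a23 /andP[p2 p3]].
have low x v : x \in support_of js2 -> v \in support_of js1 -> (r v < r x)%N.
  by rewrite !inE => ? ?; apply: a12.
have high x v : x \in support_of js2 -> v \in support_of js3 -> (r x < r v)%N.
  by rewrite !inE => ? ?; apply: a23.
split=> //.
- by rewrite a13 p1.
- rewrite support_cat disjoint_subset; apply/subsetP => x xS.
  rewrite !inE negb_or; apply/andP; split; apply/negP => xS'.
    by have := low x x xS; rewrite inE xS' => /(_ isT); rewrite ltnn.
  by have := high x x xS; rewrite inE xS' => /(_ isT); rewrite ltnn.
- move=> x v z xS yS zS xy yz; move: yS; rewrite support_cat inE => /orP[] yS.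
    by have := low x v xS yS; rewrite ltnNge (ltnW xy).
  by have := high z v zS yS; rewrite ltnNge (ltnW yz).
Qed.

Lemma no_isolated_word_restr (S1 S2 : {set T}) js V : [disjoint S1 & S2] ->
  pairing (S1 :|: S2) V -> preserved S1 V -> support_of js \subset S2 ->
  no_isolated_word js (restr S2 V) = no_isolated_word js V.
Proof.
move=> dS pV prV sS; apply: eq_in_all => j jj; congr (~~ _).
apply: (preserved_restrE dS pV prV).
exact: subset_trans (support_sub jj) sS.
Qed.

(** Centering one more word subtracts the product of its own moment with the
    moment of the remaining words.  As the word occupies an interval, this
    product is the sum over the pairings that preserve it. *)
Lemma tau_words js1 js2 : words_increasing (js1 ++ js2) ->
  tau ((\prod_(j <- js1) word (b j)) * \prod_(j <- js2) cword (b j)) =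
  \sum_(V | pairing (support_of (js1 ++ js2)) V && no_isolated_word js2 V) W V.
Proof.
elim: js2 js1 => [|j js2 IH] js1 hinc.
  rewrite big_nil mulr1 cats0.
  have -> : \prod_(j <- js1) word (b j) = word (flatten [seq b j | j <- js1]).
    by rewrite /word big_flatten big_map.
  rewrite tau_word; last by move: hinc; rewrite cats0.
  by apply: eq_bigl => V; rewrite andbT.
have [incj inc' dS cS] := words_increasing_split (hinc : words_increasing (js1 ++ [:: j] ++ js2)).
rewrite big_cons mulrA {1}/cword mulrBr mulrBl linearB /=.
rewrite -scalerAr mulr1 -scalerAl linearZ /= IH //.
have -> : (\prod_(i <- js1) word (b i)) * word (b j) =
          \prod_(i <- rcons js1 j) word (b i) by rewrite big_rcons.
rewrite IH ?cat_rcons // (bigID (preserved [set t in b j])) /=.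
have eS : support_of (js1 ++ j :: js2) =
    [set t in b j] :|: support_of (js1 ++ js2).
  by rewrite -support1 !support_cat -cat1s support_cat setUCA.
have -> : tau (word (b j)) = \sum_(V | pairing [set t in b j] V && true) W V.
  rewrite tau_word; last by move: incj; rewrite /words_increasing /= cats0.
  by apply: eq_bigl => V; rewrite andbT.
rewrite support1 in dS cS.
rewrite -(sum_pairing_weight_factor _ _ predT (no_isolated_word js2) dS cS) -eS.
rewrite [X in X + _ - _](_ : _ = \sum_(V | [&& pairing (support_of (js1 ++ j :: js2)) V,
  preserved [set t in b j] V,
   predT (restr [set t in b j] V)
   & no_isolated_word js2 (restr (support_of (js1 ++ js2)) V)]) W V).
  rewrite addrAC subrr add0r; apply: eq_bigl => V.
  by rewrite -andbA; congr (_ && _); apply: andbC.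
apply: eq_bigl => V /=; rewrite -andbA; apply: andb_id2l => pV.
rewrite andbC; apply: andb_id2l => prV; apply/esym.
apply: (no_isolated_word_restr dS) => //; first by rewrite -eS.
by rewrite support_cat subsetUr.
Qed.

Lemma tau_cwords js : words_increasing js ->
  tau (\prod_(j <- js) cword (b j)) =
  \sum_(V | pairing (support_of js) V && no_isolated_word js V) W V.
Proof. by move=> h; rewrite -(@tau_words [::]) // big_nil mul1r. Qed.

(** The same subtraction applied to the interval formed by all words of js1. *)
Lemma tau_cwords2 js1 js2 : words_increasing (js1 ++ js2) ->
  tau ((\prod_(j <- js1) cword (b j) -
        (tau (\prod_(j <- js1) cword (b j)))%:A) *
       \prod_(j <- js2) cword (b j)) =
  \sum_(V | [&& pairing (support_of (js1 ++ js2)) V, no_isolated_word (js1 ++ js2) V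
     & ~~ preserved (support_of js1) V]) W V.
Proof.
move=> hinc.
have [i1 i2 dS cS] := words_increasing_split (hinc : words_increasing ([::] ++ js1 ++ js2)).
rewrite mulrBl linearB /= -scalerAl mul1r linearZ /= -big_cat /=.
rewrite !tau_cwords // (bigID (preserved (support_of js1))) /=.
rewrite -(sum_pairing_weight_factor _ _ (no_isolated_word js1) (no_isolated_word js2) dS cS).
rewrite -support_cat.
rewrite [X in X + _ - _](_ : _ = \sum_(V | [&& pairing (support_of (js1 ++ js2)) V,
  preserved (support_of js1) V,
   no_isolated_word js1 (restr (support_of js1) V)
   & no_isolated_word js2 (restr (support_of js2) V)]) W V).
  rewrite addrAC subrr add0r; apply: eq_bigl => V.
  by rewrite -!andbA.
apply: eq_bigl => V /=; rewrite -andbA; apply: andb_id2l => pV.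
rewrite andbC; apply: andb_id2l => prV.
rewrite support_cat in pV.
rewrite (no_isolated_word_restr dS pV) // (@no_isolated_word_restr (support_of js2)) //.
- by rewrite /no_isolated_word all_cat.
- by rewrite disjoint_sym.
- by rewrite setUC.
- exact: preserved_compl dS pV prV.
Qed.

End Blocks.
End Moments.

(** * Index functions constrained by a pairing *)
Section FunctionSpaces.
Variables (T C : finType).

Definition const_on_fibres (Z : eqType) (h : T -> Z) : {set {ffun T -> C}} :=
  [set g : {ffun T -> C} | [forall x, forall y, (h x == h y) ==> (g x == g y)]].

Definition const_on_pairs (V : {set {set T}}) : {set {ffun T -> C}} :=
  [set g : {ffun T -> C} |
     [forall x, forall y, ([set x; y] \in V) ==> (g x == g y)]].

Lemma const_on_fibresP (Z : eqType) (h : T -> Z) (g : {ffun T -> C}) :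
  reflect (forall x y, h x = h y -> g x = g y) (g \in const_on_fibres h).
Proof.
rewrite inE; apply: (iffP forallP) => H x.
  by move=> y /eqP hxy; move/forallP/(_ y)/implyP: (H x) => /(_ hxy)/eqP.
by apply/forallP => y; apply/implyP => /eqP /H ->.
Qed.

Lemma const_on_pairsP (V : {set {set T}}) (g : {ffun T -> C}) :
  reflect (forall x y, [set x; y] \in V -> g x = g y) (g \in const_on_pairs V).
Proof.
rewrite inE; apply: (iffP forallP) => H x.
  by move=> y hxy; move/forallP/(_ y)/implyP: (H x) => /(_ hxy)/eqP.
by apply/forallP => y; apply/implyP => /H ->.
Qed.

Lemma card_const_on_fibres (Z : finType) (h : T -> Z) : (forall z, exists t, h t = z) ->
  #|const_on_fibres h| = (#|C| ^ #|Z|)%N.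
Proof.
move=> hS; rewrite -card_ffun.
pose f (g : {ffun Z -> C}) := [ffun t => g (h t)].
have fI : injective f.
  move=> g1 g2 /ffunP e; apply/ffunP => z; have [t <-] := hS z.
  by have := e t; rewrite !ffunE.
rewrite -(card_imset _ fI); apply: eq_card => g; apply/const_on_fibresP/imsetP.
  move=> hg; pose c z := xchoose (ex_intro (fun t => h t == z) _
     (introT eqP (svalP (cid (hS z))))).
  exists [ffun z => g (c z)] => //; apply/ffunP => t; rewrite !ffunE.
  apply: hg; apply/esym/eqP.
  exact: (xchooseP (ex_intro (fun t0 => h t0 == h t) _
     (introT eqP (svalP (cid (hS (h t))))))).
by move=> [k _ ->] x y e; rewrite !ffunE e.
Qed.
End FunctionSpaces.
Arguments const_on_fibres {T C Z}.
Arguments const_on_pairs {T C}.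

Section Links.
Variables (T Z : finType) (h : T -> Z) (V : {set {set T}}).

(** The graph on the labels obtained by joining the labels of the two ends of
    every pair.  A function on labels that takes equal values at the two ends of
    every pair is a function on its components, so comps is the number of free
    indices in a sum over such functions. *)
Definition linked : rel Z := [rel z z' | [exists p, exists p',
  [&& [set p; p'] \in V, h p == z & h p' == z']]].

Definition comps : nat := n_comp linked predT.

Lemma linkedI x y : [set x; y] \in V -> linked (h x) (h y).
Proof.
move=> xy; apply/existsP; exists x; apply/existsP; exists y.
by rewrite xy !eqxx.
Qed.

Lemma linked_sym : connect_sym linked.
Proof.
apply: sym_connect_sym => x y; apply/idP/idP;
  move=> /existsP[p /existsP[p' /and3P[pV /eqP <- /eqP <-]]];
  by apply: linkedI; rewrite setUC.
Qed.

Lemma card_comps : #|{: {z | z \in roots linked}}| = comps.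
Proof.
rewrite card_sig /comps /n_comp_mem; apply: eq_card => z.
by rewrite !inE andbT.
Qed.

Definition comp_of (z : Z) : {z | z \in roots linked} :=
  exist _ (fingraph.root linked z) (roots_root linked_sym z).

Lemma comp_of_surj c : exists z, comp_of z = c.
Proof.
exists (val c); apply: val_inj => /=; apply/eqP.
by have := valP c; rewrite /= unfold_in.
Qed.

Lemma eq_comp_of z z' : (comp_of z = comp_of z') <-> connect linked z z'.
Proof.
rewrite -(root_connect linked_sym); split; first by case=> ->.
by move=> /eqP e; apply: val_inj.
Qed.

Lemma linked_const (C : Type) (g : Z -> C) :
  (forall x y, [set x; y] \in V -> g (h x) = g (h y)) <->
  (forall z z', comp_of z = comp_of z' -> g z = g z').
Proof.
split=> H; last first.
  by move=> x y xy; apply/H/eq_comp_of/connect1/linkedI.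
move=> z z' /eq_comp_of /connectP[p]; elim: p z => [|a p IH] z /=; first by move=> _ ->.
move=> /andP[/existsP[x /existsP[y /and3P[xy /eqP <- /eqP ya]]] pa] e.
by rewrite (H _ _ xy) ya; apply: IH.
Qed.

Lemma card_linked (C : finType) :
  #|[set g : {ffun Z -> C} | [forall x, forall y,
     ([set x; y] \in V) ==> (g (h x) == g (h y))]]| = (#|C| ^ comps)%N.
Proof.
rewrite -card_comps -(card_const_on_fibres C comp_of_surj); apply: eq_card => g.
rewrite inE; apply/idP/const_on_fibresP => [H|/linked_const H].
  apply/linked_const => x y xy.
  by move/forallP/(_ x)/forallP/(_ y)/implyP/(_ xy)/eqP: H.
by apply/forallP => x; apply/forallP => y; apply/implyP => /H ->.
Qed.

Lemma card_const_on_fibres_pairs (C : finType) : (forall z, exists t, h t = z) ->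
  #|const_on_fibres h :&: const_on_pairs V : {set {ffun T -> C}}| = (#|C| ^ comps)%N.
Proof.
move=> hS; have compS c : exists t, comp_of (h t) = c.
  by have [z <-] := comp_of_surj c; have [t <-] := hS z; exists t.
rewrite -card_comps -(card_const_on_fibres C compS); apply: eq_card => g.
rewrite !in_setI; apply/andP/const_on_fibresP.
  move=> [/const_on_fibresP hg /const_on_pairsP gV] x y exy.
  pose k z := g (projT1 (cid (hS z))).
  have kh t : k (h t) = g t by apply: hg; rewrite (projT2 (cid (hS (h t)))).
  rewrite -!kh; apply: (iffLR (linked_const k)) exy => a b ab.
  by rewrite !kh; apply: gV.
move=> H; split; first by apply/const_on_fibresP => x y e; apply: H; rewrite e.
apply/const_on_pairsP => x y xy; apply: H; exact/eq_comp_of/connect1/linkedI.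
Qed.
End Links.

(** * Isotropic subspaces over the field with two elements *)
Lemma card_F2 : #|'F_2| = 2%N.
Proof. by rewrite card_Fp. Qed.

Section Isotropic.
Variable T : finType.
Local Notation Om := {ffun T -> 'F_2}.
Implicit Types S : {set Om}.

(** Sets of functions closed under addition are the subspaces, since the only
    scalars are 0 and 1; they are studied through the rank of the matrix
    listing their elements. *)
Definition add_closed S : Prop :=
  0 \in S /\ forall f g, f \in S -> g \in S -> f + g \in S.

Definition rowf (f : Om) : 'rV['F_2]_#|T| := \row_j f (enum_val j).

Definition mxS S : 'M['F_2]_(#|S|, #|T|) := \matrix_i rowf (enum_val i).

Lemma rowfI : injective rowf.
Proof.
move=> f g /rowP e; apply/ffunP => t.
by have := e (enum_rank t); rewrite !mxE enum_rankK.
Qed.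

Lemma rowf_sub S v : add_closed S -> (v <= mxS S)%MS ->
  exists2 f, f \in S & v = rowf f.
Proof.
move=> [S0 SD] /submxP[D ->].
exists (\sum_i [ffun t => D 0 i * enum_val i t]).
  apply: (big_ind (fun f : Om => f \in S)) => // i _.
  have Si := enum_valP i.
  have [->|->] : D 0 i = 0 \/ D 0 i = 1.
  - by case: (D 0 i) => [[|[|//]]] ?; [left|right]; apply: val_inj.
  - by rewrite (_ : finfun _ = 0) //; apply/ffunP => t; rewrite !ffunE mul0r.
  - rewrite (_ : finfun _ = enum_val i) //; apply/ffunP => t.
    by rewrite !ffunE mul1r.
rewrite mulmx_sum_row; apply/rowP => j; rewrite !mxE summxE sum_ffunE.
by apply: eq_bigr => i _; rewrite !mxE !ffunE.
Qed.

Lemma rowf_mem S f : f \in S -> (rowf f <= mxS S)%MS.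
Proof.
move=> fS; have -> : rowf f = row (enum_rank_in fS f) (mxS S).
  by rewrite rowK enum_rankK_in.
exact: row_sub.
Qed.

Lemma card_mxS S : add_closed S -> #|S| = (2 ^ \rank (mxS S))%N.
Proof.
move=> cS; have -> : (2 ^ \rank (mxS S))%N = #|rowg (mxS S)| by rewrite card_rowg card_F2.
rewrite -[LHS](card_imset _ rowfI).
apply: eq_card => v; rewrite inE; apply/imsetP/idP.
  by move=> [f fS ->]; apply: rowf_mem.
by move=> /(rowf_sub cS)[f fS ->]; exists f.
Qed.

Lemma add_closedI S1 S2 : add_closed S1 -> add_closed S2 -> add_closed (S1 :&: S2).
Proof.
move=> [a1 b1] [a2 b2]; split; first by rewrite inE a1.
by move=> f g; rewrite !inE => /andP[? ?] /andP[? ?]; rewrite b1 ?b2.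
Qed.

Lemma rank_cap S1 S2 : add_closed S1 -> add_closed S2 ->
  (\rank (mxS S1 :&: mxS S2) <= \rank (mxS (S1 :&: S2)))%N.
Proof.
move=> c1 c2; apply/mxrankS/row_subP => i.
have := row_sub i (mxS S1 :&: mxS S2)%MS.
rewrite sub_capmx => /andP[/(rowf_sub c1)[f f1 ->] /(rowf_sub c2)[g g2 e]].
by apply: rowf_mem; rewrite inE f1 (rowfI e).
Qed.

Definition orth S1 S2 : Prop := forall f g, f \in S1 -> g \in S2 ->
  \sum_t f t * g t = 0.

Lemma orth_mx S1 S2 : orth S1 S2 -> (mxS S1 <= kermx (mxS S2)^T)%MS.
Proof.
move=> o; apply/sub_kermxP/matrixP => i j; rewrite !mxE.
rewrite -[RHS](o _ _ (enum_valP i) (enum_valP j)) [RHS](reindex (@enum_val T predT)) /=.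
  by apply: eq_bigr => k _; rewrite !mxE.
exact/onW_bij/enum_val_bij.
Qed.

Lemma kermx_tr_sym m1 m2 n (A : 'M['F_2]_(m1, n)) (B : 'M['F_2]_(m2, n)) :
  (A <= kermx B^T)%MS = (B <= kermx A^T)%MS.
Proof.
apply/sub_kermxP/sub_kermxP => e; apply: trmx_inj;
by rewrite trmx_mul trmxK e trmx0.
Qed.

(** If a, b and s are isotropic, then (a meet s) + (b meet s) is orthogonal to
    s + (a meet b): each pair of summands lies inside one of the three spaces.
    In both sums the two summands meet in a meet b meet s, and the
    dimensions of orthogonal spaces add up to at most that of the whole space. *)
Lemma isotropic_bound Sa Sb Ss dab das dbs ds d :
  add_closed Sa -> add_closed Sb -> add_closed Ss ->
  orth Sa Sa -> orth Sb Sb -> orth Ss Ss ->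
  #|Sa :&: Sb| = (2 ^ dab)%N -> #|Sa :&: Ss| = (2 ^ das)%N ->
  #|Sb :&: Ss| = (2 ^ dbs)%N -> #|Ss| = (2 ^ ds)%N ->
  #|Sa :&: Sb :&: Ss| = (2 ^ d)%N ->
  (dab + das + dbs + ds <= #|T| + d.*2)%N.
Proof.
move=> ca cb cs oa ob os.
have cab := add_closedI ca cb; have cas := add_closedI ca cs; have cbs := add_closedI cb cs.
have inj2 a b : (2 ^ a)%N = (2 ^ b)%N -> a = b by move/eqP; rewrite eqn_exp2l // => /eqP.
have cabs := add_closedI cab cs.
rewrite (card_mxS cab) (card_mxS cas) (card_mxS cbs) (card_mxS cs) (card_mxS cabs).
move=> /inj2 <- /inj2 <- /inj2 <- /inj2 <- /inj2 <-.
set A := mxS (Sa :&: Ss); set B := mxS (Sb :&: Ss).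
set C := mxS Ss; set D := mxS (Sa :&: Sb).
have rAB := mxrank_sum_cap A B; have rCD := mxrank_sum_cap C D.
have cAB := rank_cap cas cbs; have cCD := rank_cap cs cab.
rewrite (_ : Sa :&: Ss :&: (Sb :&: Ss) = Sa :&: Sb :&: Ss) in cAB; last first.
  by rewrite setIACA setIid.
rewrite (_ : Ss :&: (Sa :&: Sb) = Sa :&: Sb :&: Ss) in cCD; last exact: setIC.
have : ((A + B)%MS <= kermx (C + D)%MS^T)%MS.
  rewrite addsmx_sub; apply/andP; split; rewrite kermx_tr_sym addsmx_sub;
    apply/andP; split; rewrite kermx_tr_sym; apply: orth_mx => f g;
    rewrite !inE => /andP[f1 f2]; try (by move=> g1; apply: os);
    move=> /andP[g1 g2]; [exact: oa | exact: ob].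
move=> /mxrankS; rewrite mxrank_ker mxrank_tr => h.
have h1 := rank_leq_col (C + D)%MS.
move: h1 h rAB rCD cAB cCD; rewrite -/A -/B -/C -/D.
set m := #|T|.
lia.
Qed.
End Isotropic.

(** * The Euler characteristic bound *)
Lemma not_preserved (T : finType) (S D : {set T}) V : pairing D V ->
  ~~ preserved S V -> exists x y, [/\ [set x; y] \in V, x \in S & y \notin S].
Proof.
move=> pV; rewrite negb_forall_in => /exists_inP[B BV]; rewrite negb_or.
have [x [y [_ eB]]] := pairing_set2 pV BV; rewrite {}eB in BV *.
rewrite disjoints_subset !subUset !sub1set !inE.
have [xS|xS] := boolP (x \in S); have [yS|yS] := boolP (y \in S) => //= _.
  by exists x, y.
by exists y, x; rewrite setUC.
Qed.

(** When every vertex has a neighbour, a component contains its root and a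
    neighbour of the root; these vertices are distinct for distinct components. *)
Section ComponentCount.
Variables (Z : finType) (e : rel Z) (eS : connect_sym e).
Hypothesis nbr : forall z, exists2 z', z' != z & e z z'.

Let nb z := s2val (cid2 (nbr z)).
Let nbN z : nb z != z. Proof. exact: (s2valP (cid2 (nbr z))). Qed.
Let nbE z : connect e z (nb z).
Proof. exact/connect1/(s2valP' (cid2 (nbr z))). Qed.

Let Ro : {set Z} := [set z in fingraph.roots e].

Let RoE z : z \in Ro -> fingraph.root e z = z.
Proof. by rewrite inE => /eqP. Qed.

Let root_nb z : fingraph.root e (nb z) = fingraph.root e z.
Proof. by apply/esym/eqP; rewrite (root_connect eS); exact: nbE. Qed.

Let card_Ro : n_comp e predT = #|Ro|.
Proof. by apply: eq_card => z; rewrite !inE andbT. Qed.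

Let card_Ro_nb : #|Ro :|: nb @: Ro| = (n_comp e predT).*2.
Proof.
have nI : {in Ro &, injective nb}.
  move=> x y xR yR exy.
  by rewrite -(RoE xR) -(RoE yR) -root_nb exy root_nb.
have -> : #|Ro :|: nb @: Ro| = (#|Ro| + #|nb @: Ro|)%N.
  apply/eqP; rewrite leq_card_setU disjoint_subset.
  apply/subsetP => x xR; rewrite !inE; apply/negP => /imsetP[y yR exy].
  have := nbN y; rewrite -exy -(RoE xR) -(RoE yR) exy root_nb.
  by rewrite eqxx.
by rewrite (card_in_imset nI) card_Ro addnn.
Qed.

Lemma double_n_comp : ((n_comp e predT).*2 <= #|Z|)%N.
Proof. by rewrite -card_Ro_nb max_card. Qed.

Lemma double_n_comp_lt a b c : a != b -> a != c -> b != c ->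
  connect e a b -> connect e a c -> ((n_comp e predT).*2 < #|Z|)%N.
Proof.
move=> ab ac bc; rewrite -!(root_connect eS) => /eqP rb /eqP rc.
set z := fingraph.root e a in rb rc.
have [x [xz xn xr]] : exists x, [/\ x != z, x != nb z & fingraph.root e x = z].
  have [az|az] := eqVneq a z; have [an|an] := eqVneq a (nb z).
  - by have := nbN z; rewrite -an az eqxx.
  - have [bn|bn] := eqVneq b (nb z).
      by exists c; rewrite -bn eq_sym -az ac eq_sym bc -rc.
    by exists b; rewrite -{1}az eq_sym ab bn -rb.
  - have [bz|bz] := eqVneq b z.
      by exists c; rewrite -an -{1}bz eq_sym bc eq_sym ac -rc.
    by exists b; rewrite -an bz eq_sym ab -rb.
  - by exists a.
rewrite -card_Ro_nb -cardsT; apply: proper_card.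
apply/properP; split; first exact: subsetT.
exists x; rewrite ?inE // negb_or; apply/andP; split.
  by apply: contra xz => /eqP e1; rewrite -xr; apply/eqP; rewrite e1.
apply/negP => /imsetP[y yR exy].
have : y = z by rewrite -(RoE yR) -root_nb -exy xr.
by move=> yz; move: xn; rewrite exy yz eqxx.
Qed.

End ComponentCount.

Section Ribbon.
Variables (E K : finType) (next : E -> E) (bl : E -> K).
Hypotheses (nextI : injective next) (blS : forall k, exists e, bl e = k).
Hypothesis blE : forall e e', (bl e == bl e') = fconnect next e e'.

Local Notation P := (E * bool)%type.
(** Letter e stands for two matrix entries, at positions (e, false) and
    (e, true).  They share their row index, which belongs to e; the column index
    of the second is that of the first entry of the next letter. *)
Definition row_slot (p : P) : E := p.1.
Definition col_slot (p : P) : E := if p.2 then next p.1 else p.1.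
Definition posn_block (p : P) : K := bl p.1.

Variable (V : {set {set P}}).
Hypothesis pV : pairing setT V.

Let addF2 (x : 'F_2) : x + x = 0.
Proof. by case: x => [[|[|//]]] ?; apply: val_inj. Qed.

Let fibres_closed (Z : eqType) (h : P -> Z) : add_closed (const_on_fibres h).
Proof.
split; first by apply/const_on_fibresP => x y _; rewrite !ffunE.
move=> f g /const_on_fibresP hf /const_on_fibresP hg; apply/const_on_fibresP => x y xy.
by rewrite !ffunE (hf _ _ xy) (hg _ _ xy).
Qed.

Let pairs_closed : add_closed (const_on_pairs V : {set {ffun P -> 'F_2}}).
Proof.
split; first by apply/const_on_pairsP => x y _; rewrite !ffunE.
move=> f g /const_on_pairsP hf /const_on_pairsP hg; apply/const_on_pairsP => x y xy.
by rewrite !ffunE (hf _ _ xy) (hg _ _ xy).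
Qed.

Let sum_P (F : P -> 'F_2) : \sum_p F p = \sum_e (F (e, true) + F (e, false)).
Proof.
transitivity (\sum_e \sum_b F (e, b)).
  by rewrite pair_bigA; apply: eq_bigr => -[].
by apply: eq_bigr => e _; rewrite big_bool.
Qed.

Let orth_row :
  orth (const_on_fibres row_slot) (const_on_fibres row_slot : {set {ffun P -> 'F_2}}).
Proof.
move=> f g /const_on_fibresP hf /const_on_fibresP hg.
rewrite sum_P big1 // => x _.
by rewrite (hf (x, true) (x, false)) // (hg (x, true) (x, false)).
Qed.

Let orth_col :
  orth (const_on_fibres col_slot) (const_on_fibres col_slot : {set {ffun P -> 'F_2}}).
Proof.
move=> f g /const_on_fibresP hf /const_on_fibresP hg.
(* The substitution aligns the two positions that share a column index. *)
rewrite sum_P big_split /=.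
rewrite [X in _ + X](reindex_inj nextI) /= -big_split big1 //= => x _.
rewrite (hf (x, true) (next x, false)) // (hg (x, true) (next x, false)) //.
Qed.

Let orth_V : orth (const_on_pairs V) (const_on_pairs V : {set {ffun P -> 'F_2}}).
Proof.
move=> f g /const_on_pairsP hf /const_on_pairsP hg.
have /andP[/and3P[/eqP cV tV _] _] := pV.
rewrite (eq_bigl (mem (cover V))); last by move=> x; rewrite cV !inE.
rewrite big_trivIset // big1 // => B BV.
have [x [y [xy eB]]] := pairing_set2 pV BV; rewrite {}eB in BV *.
rewrite big_setU1 ?inE // big_set1.
by rewrite (hf _ _ BV) (hg _ _ BV); exact: addF2.
Qed.

Let card_V : #|V| = #|E|.
Proof.
have /andP[parV /forall_inP c2] := pV.
have := card_uniform_partition (fun B BV => eqP (c2 B BV)) parV.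
rewrite cardsT card_prod card_bool => /eqP.
by rewrite eqn_pmul2r // => /eqP.
Qed.

Let card_const_on_pairs : #|const_on_pairs V : {set {ffun P -> 'F_2}}| = (2 ^ #|V|)%N.
Proof.
have /andP[/and3P[/eqP cV tV n0] _] := pV.
have inV x : pblock V x \in V by apply: pblock_mem; rewrite cV inE.
pose pi x : {B | B \in V} := exist _ (pblock V x) (inV x).
have piS B : exists t, pi t = B.
  case: B => B BV; have [x [y [xy eB]]] := pairing_set2 pV BV.
  exists x; apply: val_inj => /=; apply: def_pblock => //.
  by rewrite eB !inE eqxx.
have -> : #|V| = #|{: {B | B \in V}}| by rewrite card_sig; apply: eq_card.
rewrite -[X in (X ^ _)%N](card_Fp (isT : prime 2)).
rewrite -(card_const_on_fibres 'F_2 piS); apply: eq_card => g.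
apply/const_on_pairsP/const_on_fibresP => H x y.
  move=> /(congr1 val) /= e.
  have xB : x \in pblock V x by rewrite mem_pblock cV inE.
  have yB : y \in pblock V x by rewrite e mem_pblock cV inE.
  have [a [b [_ eB]]] := pairing_set2 pV (inV x).
  have gab : g a = g b by apply: H; rewrite -eB.
  by move: xB yB; rewrite eB !inE => /orP[]/eqP-> /orP[]/eqP->.
move=> xy; apply: H; apply: val_inj => /=.
by rewrite !(def_pblock tV xy) // !inE eqxx ?orbT.
Qed.

(** Moving alternately along equal row indices and equal column indices, one
    visits a whole cyclic word. *)
Let fibres_row_col :
  const_on_fibres row_slot :&: const_on_fibres col_slot
    = const_on_fibres posn_block :> {set {ffun P -> 'F_2}}.
Proof.
apply/setP => g; rewrite in_setI; apply/andP/const_on_fibresP; last first.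
  move=> H; split; apply/const_on_fibresP => -[x bx] [y by']; rewrite /row_slot /col_slot /=.
    by move=> ->; apply: H.
  move=> e; apply: H; apply/eqP; rewrite /posn_block /= blE.
  have bn z (b : bool) : fconnect next z (if b then next z else z).
    by case: b => //; apply: fconnect1.
  apply: connect_trans (bn x bx) _; rewrite e (fconnect_sym nextI).
  exact: bn.
move=> [/const_on_fibresP hu /const_on_fibresP hv] [x bx] [y by'] /eqP; rewrite /posn_block /= blE.
move=> /connectP[s]; elim: s x bx => [|z s IH] x bx /=.
  by move=> _ ->; apply: hu.
move=> /andP[/eqP xz ps] e; rewrite -(IH z false ps e).
rewrite (hu (x, bx) (x, true)) //; apply: hv.
by rewrite /col_slot.
Qed.

(** The functions constant along row indices, along column indices, and along
    the pairs of V are three isotropic subspaces, because each of these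
    relations groups the positions in twos.  The dimensions of their
    intersections are the numbers of row classes, column classes, words and
    components, and isotropic_bound becomes the inequality between them. *)
Lemma euler_bound : (comps row_slot V + comps col_slot V + #|K| <=
  #|E| + (comps posn_block V).*2)%N.
Proof.
have uS e : exists p, row_slot p = e by exists (e, true).
have vS e : exists p, col_slot p = e by exists (e, false).
have bS k : exists p, posn_block p = k by have [e <-] := blS k; exists (e, true).
have F2 n : (#|'F_2| ^ n)%N = (2 ^ n)%N by rewrite card_Fp.
have := @isotropic_bound P (const_on_fibres row_slot) (const_on_fibres col_slot) (const_on_pairs V)
  #|K| (comps row_slot V) (comps col_slot V) #|V| (comps posn_block V)
  (fibres_closed _) (fibres_closed _) pairs_closed orth_row orth_col orth_V.
rewrite fibres_row_col (card_const_on_fibres 'F_2 bS) F2 (card_const_on_fibres_pairs V 'F_2 uS) F2.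
rewrite (card_const_on_fibres_pairs V 'F_2 vS) F2 (card_const_on_fibres_pairs V 'F_2 bS) F2.
rewrite card_const_on_pairs => /(_ erefl erefl erefl erefl erefl).
by rewrite card_V card_prod card_bool; lia.
Qed.

Lemma linked_other_block j : ~~ preserved [set p | posn_block p == j] V ->
  exists2 j', j' != j & linked posn_block V j j'.
Proof.
move=> /(not_preserved pV)[x [y [xy]]]; rewrite !inE => /eqP <- yj.
by exists (posn_block y) => //; apply: linkedI.
Qed.

(** Each component contains two words at least, hence twice the number of
    components is at most the number of words. *)
Lemma euler_no_isolated :
  (forall j, ~~ preserved [set p | posn_block p == j] V) ->
  (comps row_slot V + comps col_slot V <= #|E|)%N.
Proof.
move=> nbl; have := double_n_comp (linked_sym _ _) (fun j => linked_other_block (nbl j)).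
have := euler_bound; rewrite /comps.
move: (n_comp _ _) (n_comp _ _) (n_comp _ _) #|K| #|E|; clear; lia.
Qed.

(** A pair leaving the union of the words a and b puts a third word into their
    common component, and the bound on the number of components is strict. *)
Lemma euler_no_isolated_lt a b :
  (forall j, ~~ preserved [set p | posn_block p == j] V) ->
  a != b -> connect (linked posn_block V) a b ->
  ~~ preserved [set p | (posn_block p == a) || (posn_block p == b)] V ->
  (comps row_slot V + comps col_slot V < #|E|)%N.
Proof.
move=> nbl ab cab /(not_preserved pV)[x [y [xy]]]; rewrite !inE => xab yab.
have gxy := connect1 (linkedI posn_block xy).
have cac : connect (linked posn_block V) a (posn_block y).
  case/orP: xab => /eqP xe; first by rewrite -xe.
  by apply: connect_trans cab _; rewrite -xe.
move: yab; rewrite negb_or eq_sym => /andP[ya yb].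
have := double_n_comp_lt (linked_sym _ _) (fun j => linked_other_block (nbl j))
  ab ya _ cab cac; rewrite eq_sym => /(_ yb).
have := euler_bound; rewrite /comps.
move: (n_comp _ _) (n_comp _ _) (n_comp _ _) #|K| #|E|; clear; lia.
Qed.
End Ribbon.

(** * Traces of products as sums over closed walks *)
Section MatrixWords.
Variables (A : pzRingType) (N : nat).

Definition consf n (C : finType) (x : C) (g : {ffun 'I_n -> C}) : {ffun 'I_n.+1 -> C} :=
  [ffun t => oapp g x (unlift ord0 t)].

Lemma consf0 n (C : finType) (x : C) (g : {ffun 'I_n -> C}) : consf x g ord0 = x.
Proof. by rewrite ffunE unlift_none. Qed.

Lemma consfS n (C : finType) (x : C) (g : {ffun 'I_n -> C}) t :
  consf x g (lift ord0 t) = g t.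
Proof. by rewrite ffunE liftK. Qed.

Lemma sum_consf n (C : finType) (x : C) (K : nmodType) (F : {ffun 'I_n.+1 -> C} -> K) :
  \sum_(g : {ffun 'I_n.+1 -> C} | g ord0 == x) F g = \sum_g F (consf x g).
Proof.
rewrite (reindex_onto (consf x) (fun g => [ffun t => g (lift ord0 t)])).
  apply: eq_bigl => g; rewrite consf0 eqxx /=; apply/eqP/ffunP => t.
  by rewrite !ffunE liftK.
move=> g /eqP <-; apply/ffunP => t; rewrite !ffunE.
by case: unliftP => [j|] -> //=; rewrite ffunE.
Qed.

(** The default y is the endpoint of the walk, attained after the last step. *)
Definition succ_val n (C : finType) (g : {ffun 'I_n -> C}) (y : C) (t : 'I_n) : C :=
  oapp g y (insub t.+1).

Lemma mulmx_paths n (F : 'I_n.+1 -> 'M[A]_N) x y :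
  (\big[mulmx/1%:M]_(t < n.+1) F t) x y =
  \sum_(g : {ffun 'I_n.+1 -> 'I_N} | g ord0 == x)
    \prod_t F t (g t) (succ_val g y t).
Proof.
elim: n F x y => [|n IH] F x y.
  rewrite big_ord_recl big_ord0 mulmx1 sum_consf.
  rewrite (big_pred1 [ffun=> x]) => [|g]; last first.
    by apply/esym/eqP/ffunP => -[].
  by rewrite big_ord_recl big_ord0 mulr1 consf0 /succ_val insubF.
rewrite big_ord_recl mxE sum_consf.
under eq_bigr => z _ do rewrite IH big_distrr /=.
rewrite (exchange_big_dep predT) //=; apply: eq_bigr => g _.
rewrite (big_pred1 (g ord0)) => [|z]; last by rewrite /= eq_sym.
rewrite [RHS]big_ord_recl consf0; congr (_ * _).
  congr (F _ _ _); rewrite /succ_val insubT /=.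
  by rewrite -(consfS x g ord0); congr (fun_of_fin _ _); apply: val_inj.
apply: eq_bigr => t _; rewrite consfS; congr (F _ _ _).
rewrite /succ_val; have [lt|ge] := ltnP t.+1 n.+1.
  rewrite !insubT /= -(consfS x g (Ordinal lt)).
  by congr (fun_of_fin _ _); apply: val_inj.
by rewrite !insubF //; apply/negbTE; rewrite -leqNgt.
Qed.

Lemma mxtrace_cycles n (F : 'I_n -> 'M[A]_N) : (0 < n)%N ->
  \tr (\big[mulmx/1%:M]_(t < n) F t) =
  \sum_(g : {ffun 'I_n -> 'I_N}) \prod_t F t (g t) (g (ordS t)).
Proof.
case: n F => // n F _; rewrite /mxtrace.
under eq_bigr => x _ do rewrite mulmx_paths.
rewrite (exchange_big_dep predT) //=; apply: eq_bigr => g _.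
rewrite (big_pred1 (g ord0)) => [|z]; last by rewrite /= eq_sym.
apply: eq_bigr => t _; congr (F _ _ _); rewrite /succ_val.
have [lt|ge] := ltnP t.+1 n.+1.
  rewrite insubT /=; congr (g _); apply: val_inj => /=.
  by rewrite modn_small.
rewrite insubF /=; last by rewrite ltnNge ge.
congr (g _); apply: val_inj => /=.
have -> : t.+1 = n.+1 by apply/eqP; rewrite eqn_leq ge ltn_ord.
by rewrite modnn.
Qed.

Lemma sum_ffun_pair (D C1 C2 : finType)
    (F : {ffun D -> C1} -> {ffun D -> C2} -> A) :
  \sum_(g : {ffun D -> C1 * C2}) F [ffun d => (g d).1] [ffun d => (g d).2] =
  \sum_a \sum_i F a i.
Proof.
rewrite pair_big /= (reindex (fun g : {ffun D -> C1 * C2} =>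
  ([ffun d => (g d).1], [ffun d => (g d).2]))) //=.
exists (fun p : {ffun D -> C1} * {ffun D -> C2} => [ffun d => (p.1 d, p.2 d)])
  => [g _|[a i] _].
  by apply/ffunP => d; rewrite !ffunE; case: (g d).
by congr (_, _); apply/ffunP => d; rewrite !ffunE.
Qed.

(** Distributivity for a product in a noncommutative ring whose factors are sums
    over function spaces of different arities: a choice of one function per
    factor is a single function on the disjoint union of the arities. *)
Lemma prod_sum_sigma k (n : 'I_k -> nat) (C : finType)
    (f : forall j, {ffun 'I_(n j) -> C} -> A) :
  \prod_j \sum_(g : {ffun 'I_(n j) -> C}) f j g =
  \sum_(G : {ffun {j & 'I_(n j)} -> C})
    \prod_j f j [ffun t => G (Tagged (fun j => 'I_(n j)) t)].
Proof.
pose T_ j : finType := {ffun 'I_(n j) -> C}.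
pose P_ j : {ffun T_ j -> A} := [ffun g => f j g].
transitivity (\prod_j \sum_(g : T_ j) P_ j g).
  by apply: eq_bigr => j _; apply: eq_bigr => g _; rewrite ffunE.
under eq_bigr => j _ do rewrite (big_tag (fun j => P_ j)).
rewrite bigA_distr_big_dep -(@big_fprod A 0 1 *%R +%R 'I_k T_ P_).
pose to (G : {ffun {j & 'I_(n j)} -> C}) : fprod T_ :=
  fprod_of_fun (fun j => [ffun t => G (Tagged (fun j => 'I_(n j)) t)] : T_ j).
pose from (t : fprod T_) : {ffun {j & 'I_(n j)} -> C} :=
  [ffun e => (t (tag e) : {ffun 'I_(n (tag e)) -> C}) (tagged e)].
rewrite (reindex to); last first.
  exists from => [G _|t _].
    by apply/ffunP => -[j t]; rewrite !ffunE fprodE ffunE.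
  apply/fprodP => j; rewrite fprodE; apply/ffunP => u.
  by rewrite !ffunE.
apply: eq_bigr => G _; apply: eq_bigr => j _.
by rewrite fprodE ffunE.
Qed.

End MatrixWords.

(** * Positions of the entries in a product of cyclic words *)
Lemma pairwise_flatten_map (U : Type) (V : Type) (rel : rel U) (f : V -> seq U) s :
  pairwise (fun a b => allrel rel (f a) (f b)) s ->
  all (fun a => pairwise rel (f a)) s ->
  pairwise rel (flatten [seq f a | a <- s]).
Proof.
elim: s => //= a s IH /andP[h1 h2] /andP[h3 h4].
rewrite pairwise_cat h3 IH // !andbT.
elim: s h1 {IH h2 h4} => [_|b s IH] /=; first by rewrite allrel0r.
by move=> /andP[h1 h2]; rewrite allrel_catr h1 IH.
Qed.

Lemma pairwise_enum_ord n : pairwise (fun a b : 'I_n => (a < b)%N) (enum 'I_n).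
Proof.
have := iota_ltn_sorted 0 n; rewrite -val_enum_ord sorted_map.
by rewrite sorted_pairwise // => x y z; apply: ltn_trans.
Qed.

Section Positions.
Variables (k : nat) (n : 'I_k -> nat).

Definition letter : finType := {j : 'I_k & 'I_(n j)}.
Definition mkletter j (t : 'I_(n j)) : letter := Tagged (fun j => 'I_(n j)) t.
Definition posn : finType := (letter * bool)%type.
Definition next_letter (e : letter) : letter := mkletter (ordS (tagged e)).
Definition block_of (e : letter) : 'I_k := tag e.

(** The factor of the block index exceeds every rank inside a block, so the
    order is lexicographic. *)
Definition posn_rank (p : posn) : nat :=
  (tag p.1 * (\sum_j (n j).*2) + (tagged p.1).*2 + p.2)%N.

Definition block_seq j : seq posn :=
  [seq (mkletter t, b) | t <- enum 'I_(n j), b <- [:: false; true]].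

Lemma mem_block_seq j p : (p \in block_seq j) = (block_of p.1 == j).
Proof.
apply/allpairsP/eqP => [[[t b] [_ _ ->]] //|<-].
case: p => -[i t] b /=; exists (t, b); split=> //=; first by rewrite mem_enum.
by case: b.
Qed.

Lemma block_seq_set j : [set p in block_seq j] = [set p | posn_block block_of p == j].
Proof. by apply/setP => p; rewrite !inE mem_block_seq. Qed.

Lemma block_seq_increasing js : pairwise (fun a b : 'I_k => (a < b)%N) js ->
  words_increasing posn_rank block_seq js.
Proof.
move=> pjs; apply: pairwise_flatten_map.
  apply: sub_pairwise pjs => a b ab.
  apply/allrelP => p p'; rewrite !mem_block_seq => /eqP ea /eqP eb.
  rewrite /posn_rank; move: ab; rewrite -ea -eb /block_of.
  case: p p' {ea eb} => -[j t] c [[j' t'] c'] /= ab.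
  have : ((n j).*2 <= \sum_j (n j).*2)%N by rewrite (bigD1 j) //= leq_addr.
  set D := bigop _ _ _ => hD.
  have : (j.+1 * D <= j' * D)%N by rewrite leq_mul2r ab orbT.
  have := ltn_ord t; rewrite mulSn -!muln2 in hD *.
  by case: c c' => [] []; lia.
apply/allP => j _; apply: pairwise_flatten_map.
  apply: sub_pairwise (pairwise_enum_ord (n j)) => t t' tt.
  by apply/allrelP => p p'; rewrite !inE => /orP[]/eqP-> /orP[]/eqP->;
     rewrite /posn_rank /=; lia.
apply/allP => t _ /=; rewrite /posn_rank /= !andbT; lia.
Qed.

Lemma support_block_seq js : support_of block_seq js = [set p | posn_block block_of p \in js].
Proof.
apply/setP => p; rewrite !inE; apply/flattenP/idP.
  by move=> [_ /mapP[j jj ->]]; rewrite mem_block_seq => /eqP e; rewrite /posn_block e.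
move=> h; exists (block_seq (posn_block block_of p)); first exact: map_f.
by rewrite mem_block_seq.
Qed.

Lemma next_letter_inj : injective next_letter.
Proof.
move=> [j t] [j' t'] /= e; have ej : j = j' by have := congr1 tag e.
case: _ / ej t' e => t' /eqP; rewrite eq_Tagged /= => /eqP e.
by congr existT; apply: (can_inj (@ordSK _)).
Qed.

Lemma iter_ordS m (t : 'I_m) i : val (iter i (@ordS m) t) = ((t + i) %% m)%N.
Proof.
elim: i => [|i IH] /=; first by rewrite addn0 modn_small.
by rewrite IH addnS -[in RHS]addn1 -[in LHS]addn1 modnDml.
Qed.

(** Each word is a single cycle of next_letter. *)
Lemma block_ofE e e' : (block_of e == block_of e') = fconnect next_letter e e'.
Proof.
apply/eqP/idP; last first.
  by move=> /connectP[p]; elim: p e => [|x p IH] e /= => [_ -> //|/andP[/eqP <- pp] /(IH _ pp)].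
case: e e' => j t [j' t']; rewrite /block_of /= => ej.
case: _ / ej t' => t'.
have it i : iter i next_letter (mkletter t) = mkletter (iter i (@ordS _) t).
  by elim: i => //= i ->.
have -> : existT (fun j => 'I_(n j)) j t' =
   iter (t' + (n j - t)) next_letter (mkletter t).
  rewrite it; congr existT; apply: val_inj.
  rewrite iter_ordS; have := ltn_ord t; have := ltn_ord t' => lt' lt.
  by rewrite addnCA subnKC ?(ltnW lt) // modnDr modn_small.
exact: fconnect_iter.
Qed.
End Positions.

(** * Genus expansion of the moments of centered traces *)
Lemma prod_enum (K : pzRingType) (T : finType) (F : T -> K) :
  \prod_(t <- enum T) F t = \prod_t F t.
Proof. by rewrite enumT [index_enum T]unlock. Qed.

Section PairProducts.
Variables (T : finType) (r : T -> nat) (rI : injective r) (D : {set T}).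
Variables (V : {set {set T}}) (pV : pairing D V).

Lemma card_ordered_pairs :
  #|[pred p : T * T | (r p.1 < r p.2)%N && ([set p.1; p.2] \in V)]| = #|V|.
Proof.
set O := [set p : T * T | (r p.1 < r p.2)%N && ([set p.1; p.2] \in V)].
have eV : V = [set [set p.1; p.2] | p in O].
  apply/setP => B; apply/idP/imsetP => [BV|[p]]; last first.
    by rewrite inE => /andP[_ h] ->.
  have [x [y [xy eB]]] := pairing_set2 pV BV.
  have : r x != r y by apply: contra xy => /eqP /rI ->.
  rewrite neq_ltn => /orP[h|h]; first by exists (x, y); [rewrite inE /= h -eB | exact: eB].
  have eB' : B = [set y; x] by rewrite setUC.
  by exists (y, x); [rewrite inE /= h -eB' | exact: eB'].
rewrite [in RHS]eV card_in_imset; first by apply: eq_card => p; rewrite !inE.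
move=> [x y] [x' y']; rewrite !inE /= => /andP[xy _] /andP[xy' _] e.
have : x \in [set x'; y'] by rewrite -e !inE eqxx.
have : y \in [set x'; y'] by rewrite -e !inE eqxx orbT.
rewrite !inE => /orP[]/eqP ey /orP[]/eqP ex; rewrite ex ey // in xy *.
- by rewrite ltnn in xy.
- by have := ltn_trans xy xy'; rewrite ltnn.
- by rewrite ltnn in xy.
Qed.

(** Each pair is listed once among the ordered ones, and the factor 0 of a pair
    violating the condition c kills the product. *)
Lemma prod_ordered_pairs (K : comPzRingType) (x : K) (c : rel T) :
  symmetric c ->
  \prod_(p : T * T | (r p.1 < r p.2)%N && ([set p.1; p.2] \in V))
    (x * (c p.1 p.2)%:R) =
  x ^+ #|V| * [forall a, forall b, ([set a; b] \in V) ==> c a b]%:R.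
Proof.
move=> cS; rewrite big_split /= prodr_const; congr (_ ^+ _ * _).
  exact: card_ordered_pairs.
case: (boolP [forall a, _]) => [H|].
  rewrite big1 // => p /andP[_ pV']; move/forallP/(_ p.1)/forallP/(_ p.2): H.
  by rewrite pV' /= => ->.
rewrite negb_forall => /existsP[a]; rewrite negb_forall => /existsP[b].
rewrite negb_imply => /andP[ab nc].
wlog lab : a b ab nc / (r a < r b)%N.
  move=> W; have : r a != r b.
    by apply: contra (pairing_neq pV ab) => /eqP /rI ->.
  rewrite neq_ltn => /orP[|l]; first exact: W ab nc.
  by apply: (W b a) => //; rewrite 1?setUC // cS.
by rewrite (bigD1 (a, b)) /= ?lab // (negbTE nc) mul0r.
Qed.
End PairProducts.

Section FirstBlock.
Variables (k : nat) (n : 'I_k.+1 -> nat) (C : finType).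

Definition lift_letter (e : letter (fun j : 'I_k => n (lift ord0 j))) : letter n :=
  @mkletter _ n (lift ord0 (tag e)) (tagged e).

(** Separates the index sum of the first word from those of the other words,
    and, applied twice, those of the first two words. *)
Lemma sum_first_block (K : nmodType)
    (F : {ffun 'I_(n ord0) -> C} ->
         {ffun letter (fun j : 'I_k => n (lift ord0 j)) -> C} -> K) :
  \sum_(G : {ffun letter n -> C})
    F [ffun t : 'I_(n ord0) => G (mkletter t)] [ffun e => G (lift_letter e)] =
  \sum_g \sum_G F g G.
Proof.
pose split (G : {ffun letter n -> C}) :=
  ([ffun t : 'I_(n ord0) => G (mkletter t)], [ffun e => G (lift_letter e)]).
rewrite pair_big /= [RHS](reindex split) //=.
apply: onW_bij; apply: inj_card_bij => [G G' [/ffunP e0 /ffunP e1]|].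
  apply/ffunP => -[j t]; case: (unliftP ord0 j) => [i|] ej.
    move: t; rewrite ej => t.
    by have := e1 (mkletter (n := fun j : 'I_k => n (lift ord0 j)) t); rewrite !ffunE.
  by move: t; rewrite ej => t; have := e0 t; rewrite !ffunE.
rewrite card_prod !card_ffun !card_tagged !sumnE !big_map -!enumT !big_enum /=.
rewrite [X in (_ <= _ ^ X)%N]big_ord_recl expnD.
by rewrite !card_ord leq_mul2l; apply/orP; right; apply: eq_leq; congr (_ ^ _)%N.
Qed.
End FirstBlock.

Definition entry_at (A : Type) (I : Type) M N (X : I -> 'M[A]_(M, N))
  (e : I * 'I_M * 'I_N) : A := X e.1.1 e.1.2 e.2.

Section WishartMoments.
Variables (R : realType) (A : ncProbSpace R) (q : R) (N M : nat).
Variables (I : finType) (X : I -> 'M[A]_(M, N)).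
Local Notation Xe := (entry_at X).
Hypothesis XG : jointly_qgaussian q Xe.
Hypothesis Xcov : forall k k' i i' j j',
  nc_tau A (X k i j * X k' i' j') =
  ((1%:M : 'M[R]_M) i i' * (N%:R^-1 *: 1%:M : 'M[R]_N) j j' * (k == k')%:R)%:C.

Local Notation tau := (nc_tau A).

Definition wprod n (c : 'I_n -> I) : 'M[A]_N :=
  \big[mulmx/1%:M]_(t < n) (adjmx (X (c t)) *m X (c t)).

Definition ctrace n (c : 'I_n -> I) : A :=
  \tr (wprod c) - (tau (\tr (wprod c)))%:A.

Definition cycle_term n (c : 'I_n -> I) (g : {ffun 'I_n -> 'I_M * 'I_N}) : A :=
  \prod_t (Xe (c t, (g t).1, (g t).2) * Xe (c t, (g t).1, (g (ordS t)).2)).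

Lemma trace_wprod n (c : 'I_n -> I) : (0 < n)%N ->
  \tr (wprod c) = \sum_g cycle_term c g.
Proof.
move=> n0; rewrite mxtrace_cycles //.
pose F (a : {ffun 'I_n -> 'I_M}) (i : {ffun 'I_n -> 'I_N}) : A :=
  \prod_t (Xe (c t, a t, i t) * Xe (c t, a t, i (ordS t))).
transitivity (\sum_a \sum_i F a i); last first.
  rewrite -sum_ffun_pair; apply: eq_bigr => g _; apply: eq_bigr => t _.
  by rewrite !ffunE.
rewrite exchange_big; apply: eq_bigr => i _ /=.
rewrite -(bigA_distr_bigA (fun t a => Xe (c t, a, i t) * Xe (c t, a, i (ordS t)))).
apply: eq_bigr => t _; rewrite mxE; apply: eq_bigr => a _; rewrite !mxE.
by have := XG.1 (c t, a, i t); rewrite /entry_at /= => ->.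
Qed.

(** The empty word is not an exception: its trace is the scalar N, its only
    cycle term is 1, and both are annihilated by centering. *)
Lemma ctraceE n (c : 'I_n -> I) :
  ctrace c = \sum_g (cycle_term c g - (tau (cycle_term c g))%:A).
Proof.
rewrite /ctrace; have [n0|n0] := posnP n; last first.
  by rewrite trace_wprod // linear_sum sumrB scaler_suml.
case: _ / (esym n0) c => c.
rewrite big1 => [|g _]; last by rewrite /cycle_term big_ord0 nc_tau1 scale1r subrr.
rewrite /wprod big_ord0 mxtrace1.
by rewrite raddfMn /= nc_tau1 scaler_nat subrr.
Qed.

Variables (k : nat) (n : 'I_k -> nat) (col : letter n -> I).

Definition colors_agree (V : {set {set posn n}}) : bool :=
  [forall p, forall p', ([set p; p'] \in V) ==> (col p.1 == col p'.1)].

Definition no_isolated_block (V : {set {set posn n}}) : bool :=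
  [forall j, ~~ preserved [set p | posn_block (@block_of k n) p == j] V].

(** A covariance 1/N per letter, and a sum over free row and column indices. *)
Definition qweight (V : {set {set posn n}}) : R :=
  q ^+ crossing_count (@posn_rank k n) V *
  (N%:R ^- #|letter n| * M%:R ^+ comps (@row_slot (letter n)) V *
   N%:R ^+ comps (col_slot (@next_letter k n)) V).

(** G assigns to a letter its row index and the column index of its first
    entry. *)
Definition label (G : {ffun letter n -> 'I_M * 'I_N}) (p : posn n) : I * 'I_M * 'I_N :=
  (col p.1, (G (row_slot p)).1, (G (col_slot (@next_letter k n) p)).2).

Lemma word_block_seq G j : word Xe (label G) (block_seq n j) =
  cycle_term (fun t : 'I_(n j) => col (mkletter t))
             [ffun t : 'I_(n j) => G (mkletter t)].
Proof.
rewrite /word /block_seq big_allpairs_dep prod_enum.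
apply: eq_bigr => t _; rewrite !big_cons big_nil /= mulr1 /label /= !ffunE.
by [].
Qed.

Lemma posn_rank_inj : injective (@posn_rank k n).
Proof.
have := block_seq_increasing n (pairwise_enum_ord k).
rewrite /words_increasing /increasing; set s := flatten _ => ps.
have sT p : p \in s.
  apply/flattenP; exists (block_seq n (block_of p.1)); last by rewrite mem_block_seq.
  by apply: map_f; rewrite mem_enum.
move=> p p' e.
have H (a b : posn n) : (index a s < index b s)%N -> posn_rank a != posn_rank b.
  move=> ab; rewrite neq_ltn; apply/orP; left.
  have hs x : index x s \in gtn (size s) by rewrite unfold_in /= index_mem.
  move/(pairwiseP a): ps => H; have := H _ _ (hs a) (hs b) ab.
  by rewrite !nth_index.
case: (ltngtP (index p s) (index p' s)) => [/H|/H|h].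
- by rewrite e eqxx.
- by rewrite e eqxx.
- by rewrite -(nth_index p (sT p)) h nth_index.
Qed.

Lemma cov_label G p p' : cov_of Xe (label G) p p' =
  (N%:R^-1)%:C * [&& col p.1 == col p'.1, (G (row_slot p)).1 == (G (row_slot p')).1 &
     (G (col_slot (@next_letter k n) p)).2 == (G (col_slot (@next_letter k n) p')).2]%:R.
Proof.
rewrite /cov_of /entry_at Xcov !mxE /= (_ : forall b : bool, b%:R = (b%:R)%:C :> R[i]); last first.
  by case.
rewrite -rmorphM; congr (_%:C).
by do 3 case: (_ == _); rewrite /= ?(mul0r, mulr0, mul1r, mulr1).
Qed.

(** For fixed V the covariances factor into conditions on the colors, on the row
    indices and on the column indices, and the functions satisfying the last two
    are counted by card_linked. *)
Lemma sum_pairing_weight_label V : pairing setT V ->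
  \sum_G pairing_weight (@posn_rank k n) q%:C (cov_of Xe (label G)) V =
  (colors_agree V)%:R * (qweight V)%:C.
Proof.
move=> pV.
have cardV : #|V| = #|letter n|.
  have /andP[parV /forall_inP c2] := pV.
  have := card_uniform_partition (fun B BV => eqP (c2 B BV)) parV.
  by rewrite cardsT card_prod card_bool => /eqP; rewrite eqn_pmul2r // => /eqP.
pose ca (a : {ffun letter n -> 'I_M}) := [forall p, forall p',
   ([set p; p'] \in V) ==> (a (row_slot p) == a (row_slot p'))].
pose ci (i : {ffun letter n -> 'I_N}) := [forall p, forall p',
   ([set p; p'] \in V) ==>
     (i (col_slot (@next_letter k n) p) == i (col_slot (@next_letter k n) p'))].
pose K : R[i] := (colors_agree V)%:R *
  (q ^+ crossing_count (@posn_rank k n) V * N%:R^-1 ^+ #|V|)%:C.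
transitivity (\sum_(G : {ffun letter n -> 'I_M * 'I_N})
  K * ((ca [ffun e => (G e).1])%:R * (ci [ffun e => (G e).2])%:R)).
  apply: eq_bigr => G _; rewrite /pairing_weight /pair_weight.
  under eq_bigr => p _ do rewrite cov_label.
  rewrite (@prod_ordered_pairs _ _ posn_rank_inj _ _ pV _ _ (fun p p' : posn n =>
    [&& col p.1 == col p'.1, (G (row_slot p)).1 == (G (row_slot p')).1 &
        (G (col_slot (@next_letter k n) p)).2 == (G (col_slot (@next_letter k n) p')).2]));
    last by move=> p p'; congr [&& _, _ & _]; rewrite eq_sym.
  set b := [forall a, _].
  have -> : b = [&& colors_agree V, ca [ffun e => (G e).1] & ci [ffun e => (G e).2]].
    apply/forallP/and3P.
      by move=> H; split; apply/forallP => p; apply/forallP => p'; apply/implyP => pp;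
        move/forallP/(_ p')/implyP/(_ pp)/and3P: (H p) => [h1 h2 h3]; rewrite ?ffunE.
    move=> [/forallP H1 /forallP H2 /forallP H3] p; apply/forallP => p'.
    apply/implyP => pp.
    move/forallP/(_ p')/implyP/(_ pp): (H1 p) => ->.
    move/forallP/(_ p')/implyP/(_ pp): (H2 p); rewrite !ffunE => ->.
    by move/forallP/(_ p')/implyP/(_ pp): (H3 p); rewrite !ffunE => ->.
  rewrite /K rmorphM !rmorphXn -!mulnb !natrM /=.
  by rewrite mulrA [in RHS](mulrC (colors_agree V)%:R) -[RHS]mulrA.
rewrite (sum_ffun_pair (fun a i => K * ((ca a)%:R * (ci i)%:R))).
under eq_bigr => a _ do rewrite -mulr_sumr -mulr_sumr.
rewrite -mulr_sumr -mulr_suml.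
have sumb (U : finType) (b : pred U) : \sum_u (b u)%:R = #|[set u | b u]|%:R :> R[i].
  by rewrite -sum1_card natr_sum [RHS]big_mkcond; apply: eq_bigr => u _; rewrite inE; case: (b u).
rewrite !sumb !card_linked !card_ord /K /qweight cardV -!mulrA; congr (_ * _).
move: (comps _ V) (comps _ V) (crossing_count _ V) #|letter n| => cu cv cr l.
have natrMC a b : (a%:R * b%:R : R)%:C = a%:R * b%:R :> R[i].
  by rewrite rmorphM !rmorph_nat.
by rewrite -exprVn -!natrX (mulrA (q ^+ cr)) [RHS]rmorphM -natrMC.
Qed.

Lemma tau_sum_label (P : pred {set {set posn n}}) :
  \sum_G \sum_(V | pairing setT V && P V)
    pairing_weight (@posn_rank k n) q%:C (cov_of Xe (label G)) V =
  \sum_(V | pairing setT V && P V) (colors_agree V)%:R * (qweight V)%:C.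
Proof.
rewrite exchange_big; apply: eq_bigr => V /andP[pV _].
exact: sum_pairing_weight_label.
Qed.

Local Notation ctr j := (ctrace (fun t : 'I_(n j) => col (mkletter t))).

Lemma ctr_expand : \prod_j ctr j =
  \sum_G \prod_j cword Xe (label G) (block_seq n j).
Proof.
under eq_bigr => j _ do rewrite ctraceE.
rewrite (prod_sum_sigma (fun j g => cycle_term (fun t : 'I_(n j) => col (mkletter t)) g
  - (tau (cycle_term (fun t : 'I_(n j) => col (mkletter t)) g))%:A)).
apply: eq_bigr => G _; apply: eq_bigr => j _.
by rewrite /cword word_block_seq.
Qed.

Lemma no_isolated_wordE V : no_isolated_word (block_seq n) (enum 'I_k) V = no_isolated_block V.
Proof.
apply/allP/forallP => H j; last by rewrite block_seq_set.
by rewrite -block_seq_set; apply: H; rewrite mem_enum.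
Qed.

Lemma support_all : support_of (block_seq n) (enum 'I_k) = setT.
Proof. by apply/setP => p; rewrite support_block_seq !inE mem_enum. Qed.

Lemma tau_prod_ctrace : tau (\prod_j ctr j) =
  \sum_(V | pairing setT V && no_isolated_block V)
    (colors_agree V)%:R * (qweight V)%:C.
Proof.
rewrite ctr_expand linear_sum -tau_sum_label; apply: eq_bigr => G _ /=.
rewrite -prod_enum (@tau_cwords _ _ _ _ _ XG _ (@posn_rank k n)); last first.
  exact/block_seq_increasing/pairwise_enum_ord.
by apply: eq_bigl => V; rewrite support_all no_isolated_wordE.
Qed.

End WishartMoments.

Definition first_two_blocks k (n : 'I_k.+2 -> nat) : {set posn n} :=
  [set p | (posn_block (@block_of _ n) p == ord0) ||
           (posn_block (@block_of _ n) p == lift ord0 ord0)].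

Section CenteredPair.
Variables (R : realType) (A : ncProbSpace R) (q : R) (N M : nat).
Variables (I : finType) (X : I -> 'M[A]_(M, N)).
Local Notation Xe := (entry_at X).
Hypothesis XG : jointly_qgaussian q Xe.
Hypothesis Xcov : forall k k' i i' j j',
  nc_tau A (X k i j * X k' i' j') =
  ((1%:M : 'M[R]_M) i i' * (N%:R^-1 *: 1%:M : 'M[R]_N) j j' * (k == k')%:R)%:C.

Local Notation tau := (nc_tau A).
Variables (k : nat) (n : 'I_k.+2 -> nat) (col : letter n -> I).
Local Notation ctr j := (ctrace X (fun t : 'I_(n j) => col (mkletter t))).
Local Notation j0 := (ord0 : 'I_k.+2).
Local Notation j1 := (lift ord0 ord0 : 'I_k.+2).

(** The index sums of the first two words are separated from the others, so that
    the scalar subtracted from their product can be expanded as well; they are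
    merged again before tau_cwords2 is applied. *)
Lemma tau_centered_pair :
  tau ((ctr j0 * ctr j1 - (tau (ctr j0 * ctr j1))%:A) *
       \prod_(j < k) ctr (lift ord0 (lift ord0 j))) =
  \sum_(V | pairing setT V && (no_isolated_block V &&
      ~~ preserved (first_two_blocks n) V))
    (colors_agree col V)%:R * (qweight q N M V)%:C.
Proof.
rewrite -(tau_sum_label q Xcov col).
pose c j (g : {ffun 'I_(n j) -> 'I_M * 'I_N}) : A :=
  let z := cycle_term X (fun t : 'I_(n j) => col (mkletter t)) g in
  z - (tau z)%:A.
pose D (G : {ffun letter (fun j : 'I_k => n (lift ord0 (lift ord0 j))) -> 'I_M * 'I_N}) :=
  \prod_(j < k) c (lift ord0 (lift ord0 j))
     [ffun t : 'I_(n (lift ord0 (lift ord0 j))) =>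
        G (mkletter (n := fun j : 'I_k => n (lift ord0 (lift ord0 j))) t)].
pose Psi (a b : A) : A := a * b - (tau (a * b))%:A.
have PsiS (U U' : finType) (a : U -> A) (b : U' -> A) :
    Psi (\sum_u a u) (\sum_u b u) = \sum_u \sum_u' Psi (a u) (b u').
  rewrite /Psi mulr_suml linear_sum scaler_suml -sumrB; apply: eq_bigr => u _ /=.
  by rewrite mulr_sumr linear_sum scaler_suml -sumrB.
transitivity (\sum_g \sum_g' \sum_G tau (Psi (c j0 g) (c j1 g') * D G)).
  under eq_bigr => j _ do rewrite (ctraceE XG).
  rewrite !(ctraceE XG) (prod_sum_sigma (fun j => c (lift ord0 (lift ord0 j)))).
  rewrite -/(Psi _ _) PsiS mulr_suml linear_sum /=; apply: eq_bigr => g _.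
  rewrite mulr_suml linear_sum /=; apply: eq_bigr => g' _.
  by rewrite mulr_sumr linear_sum.
pose F1 g (H : {ffun letter (fun j : 'I_k.+1 => n (lift ord0 j)) -> 'I_M * 'I_N}) : R[i] :=
  tau (Psi (c j0 g) (c j1 [ffun t : 'I_(n j1) =>
        H (@mkletter _ (fun j : 'I_k.+1 => n (lift ord0 j)) ord0 t)]) *
    D [ffun e => H (@lift_letter k (fun j : 'I_k.+1 => n (lift ord0 j)) e)]).
transitivity (\sum_g \sum_H F1 g H).
  apply: eq_bigr => g _.
  exact: (esym (@sum_first_block k (fun j : 'I_k.+1 => n (lift ord0 j)) _ _
    (fun g' G => tau (Psi (c j0 g) (c j1 g') * D G)))).
rewrite -(@sum_first_block _ n _ _ F1).
apply: eq_bigr => G _.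
have eE : enum 'I_k.+2 = [:: j0; j1] ++ [seq lift ord0 (lift ord0 j) | j <- enum 'I_k].
  by rewrite !enum_ordSl /= -map_comp.
pose cw j := cword Xe (label col G) (block_seq n j).
have cE j : c j [ffun t : 'I_(n j) => G (mkletter t)] = cw j.
  by rewrite /cw /cword (word_block_seq X col G).
transitivity (tau (Psi (cw j0) (cw j1) * \prod_(j < k) cw (lift ord0 (lift ord0 j)))).
  congr (tau (Psi _ _ * _)).
  - by rewrite -cE.
  - by rewrite -cE; congr (c _ _); apply/ffunP => t; rewrite !ffunE.
  - apply: eq_bigr => j _; rewrite -cE; congr (c _ _).
    by apply/ffunP => t; rewrite !ffunE.
have := @tau_cwords2 _ _ _ _ _ XG _ (@posn_rank _ n)
  (label col G)
  _ (block_seq n) [:: j0; j1] [seq lift ord0 (lift ord0 j) | j <- enum 'I_k].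
rewrite -eE => /(_ (block_seq_increasing n (pairwise_enum_ord _))).
rewrite big_map !big_cons big_nil mulr1 prod_enum => ->.
apply: eq_bigl => V; rewrite support_all no_isolated_wordE support_block_seq.
congr (_ && (_ && ~~ preserved _ V)).
by apply/setP => p; rewrite /first_two_blocks !inE.
Qed.
End CenteredPair.

(** * Linear combinations of the traces of two q-orthogonal families *)
Lemma sum_ffun_cons n (C : finType) (K : nmodType) (F : {ffun 'I_n.+1 -> C} -> K) :
  \sum_g F g = \sum_x \sum_g F (consf x g).
Proof.
rewrite (partition_big (fun g : {ffun 'I_n.+1 -> C} => g ord0) predT) //=.
by apply: eq_bigr => x _; rewrite sum_consf.
Qed.

Section LinearCombinations.
Variables (R : realType) (A : ncProbSpace R) (q : R) (N M s : nat).
Variables (X : 'I_s + 'I_s -> 'M[A]_(M, N)).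
Hypothesis XG : jointly_qgaussian q (entry_at X).
Hypothesis Xcov : forall k k' i i' j j',
  nc_tau A (X k i j * X k' i' j') =
  ((1%:M : 'M[R]_M) i i' * (N%:R^-1 *: 1%:M : 'M[R]_N) j j' * (k == k')%:R)%:C.
Variables (r : nat) (words : 'I_r -> seq 'I_s) (a : 'I_r -> R[i]).

Local Notation tau := (nc_tau A).

(** The boolean selects the family: false gives X, true its copy Y. *)
Definition copy (b : bool) (x : 'I_s) : 'I_s + 'I_s := if b then inr x else inl x.

Lemma copy_eq b c x y : (copy b x == copy c y) = (x == y) && (b == c).
Proof. by case: b c => [] []; rewrite ?andbT ?andbF. Qed.

Definition word_trace l b : A :=
  ctrace X (fun t : 'I_(size (words l)) => copy b (tnth (in_tuple (words l)) t)).

(** f false X + f true Y, where X and Y are the centered traces of the polynomial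
    with monomials words and coefficients a in the two families. *)
Definition comb (f : bool -> R[i]) : A :=
  \sum_(d : 'I_r * bool) (a d.1 * f d.2) *: word_trace d.1 d.2.

Section Words.
Variables (k : nat) (w : 'I_k -> 'I_r).

Definition wsize (j : 'I_k) : nat := size (words (w j)).

Definition letter_of (e : letter wsize) : 'I_s :=
  tnth (in_tuple (words (w (tag e)))) (tagged e).

Definition letters_agree (V : {set {set posn wsize}}) : bool :=
  [forall p, forall p', ([set p; p'] \in V) ==> (letter_of p.1 == letter_of p'.1)].

(** The entries of different families have covariance 0, so the choice e of
    families must be constant along the links of V. *)
Definition copies_agree (e : {ffun 'I_k -> bool}) (V : {set {set posn wsize}}) : bool :=
  [forall j, forall j', linked (posn_block (@block_of k wsize)) V j j' ==> (e j == e j')].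

Definition copy_sum (f : 'I_k -> bool -> R[i]) V : R[i] :=
  \sum_(e : {ffun 'I_k -> bool} | copies_agree e V) \prod_j f j (e j).

Lemma colors_agreeE (e : {ffun 'I_k -> bool}) V :
  colors_agree (fun u : letter wsize => copy (e (tag u)) (letter_of u)) V =
  letters_agree V && copies_agree e V.
Proof.
apply/forallP/andP => [H|[/forallP H1 /forallP H2] p].
  split; apply/forallP.
    move=> p; apply/forallP => p'; apply/implyP => pp.
    by move/forallP/(_ p')/implyP/(_ pp): (H p); rewrite copy_eq => /andP[].
  move=> j; apply/forallP => j'; apply/implyP.
  move=> /existsP[p /existsP[p' /and3P[pp /eqP <- /eqP <-]]].
  by move/forallP/(_ p')/implyP/(_ pp): (H p); rewrite copy_eq => /andP[].
apply/forallP => p'; apply/implyP => pp; rewrite copy_eq.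
move/forallP/(_ p')/implyP/(_ pp): (H1 p) => -> /=.
move/forallP/(_ (posn_block (@block_of k wsize) p'))/implyP:
  (H2 (posn_block (@block_of k wsize) p)).
by apply; apply: linkedI.
Qed.

Lemma sum_copies (f : 'I_k -> bool -> R[i]) (P : pred {set {set posn wsize}}) :
  \sum_(e : {ffun 'I_k -> bool}) (\prod_j f j (e j)) *
     (\sum_(V | pairing setT V && P V)
        (colors_agree (fun u : letter wsize => copy (e (tag u)) (letter_of u)) V)%:R
        * (qweight q N M V)%:C) =
  \sum_(V | pairing setT V && P V)
     (letters_agree V)%:R * copy_sum f V * (qweight q N M V)%:C.
Proof.
under eq_bigr do rewrite mulr_sumr.
rewrite exchange_big; apply: eq_bigr => V _ /=.
rewrite /copy_sum mulr_sumr mulr_suml [RHS]big_mkcond; apply: eq_bigr => e _.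
rewrite colors_agreeE mulrA; case: (letters_agree V) (copies_agree e V) => [] [] /=;
  by rewrite ?(mul0r, mulr0, mul1r, mulr1).
Qed.
End Words.

Local Notation term w e j := (word_trace (w j) (e j)).

Lemma prod_comb k (f : 'I_k -> bool -> R[i]) :
  \prod_j comb (f j) =
  \sum_(w : {ffun 'I_k -> 'I_r}) \sum_(e : {ffun 'I_k -> bool})
    (\prod_j a (w j) * \prod_j f j (e j)) *: \prod_j term w e j.
Proof.
pose F (w : {ffun 'I_k -> 'I_r}) (e : {ffun 'I_k -> bool}) : A :=
    (\prod_j a (w j) * \prod_j f j (e j)) *: \prod_j term w e j.
rewrite /comb (bigA_distr_bigA (fun j d => (a d.1 * f j d.2) *: word_trace d.1 d.2)).
rewrite -(sum_ffun_pair F); apply: eq_bigr => g _.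
rewrite /F scaler_prod -big_split /=; congr (_ *: _); apply: eq_bigr => j _;
by rewrite !ffunE.
Qed.

Lemma tau_prod_comb k (f : 'I_k -> bool -> R[i]) :
  tau (\prod_j comb (f j)) =
  \sum_(w : {ffun 'I_k -> 'I_r}) (\prod_j a (w j)) *
    \sum_(V | pairing setT V && no_isolated_block V)
      (@letters_agree k w V)%:R * copy_sum f V * (qweight q N M V)%:C.
Proof.
rewrite prod_comb linear_sum; apply: eq_bigr => w _ /=.
rewrite -sum_copies linear_sum mulr_sumr; apply: eq_bigr => e _ /=.
rewrite linearZ /= -mulrA; congr (_ * (_ * _)).
exact: (tau_prod_ctrace XG Xcov (fun u : letter (wsize w) => copy (e (tag u)) (letter_of u))).
Qed.

Lemma tau_centered_comb k (f : 'I_k.+2 -> bool -> R[i]) :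
  let D := comb (f ord0) * comb (f (lift ord0 ord0)) in
  tau ((D - (tau D)%:A) * \prod_j comb (f (lift ord0 (lift ord0 j)))) =
  \sum_(w : {ffun 'I_k.+2 -> 'I_r}) (\prod_j a (w j)) *
    \sum_(V | pairing setT V && (no_isolated_block V &&
        ~~ preserved (first_two_blocks (wsize w)) V))
      (@letters_agree _ w V)%:R * copy_sum f V * (qweight q N M V)%:C.
Proof.
pose Psi (x y : A) : A := x * y - (tau (x * y))%:A.
have PsiS (U U' : finType) (x : U -> A) (y : U' -> A) :
    Psi (\sum_u x u) (\sum_u y u) = \sum_u \sum_u' Psi (x u) (y u').
  rewrite /Psi mulr_suml linear_sum scaler_suml -sumrB; apply: eq_bigr => u _ /=.
  by rewrite mulr_sumr linear_sum scaler_suml -sumrB.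
have PsiZ c d x y : Psi (c *: x) (d *: y) = (c * d) *: Psi x y.
  have tauZ u z : tau (u *: z) = u * tau z by rewrite linearZ.
  by rewrite /Psi -scalerAl -scalerAr scalerA tauZ scalerBr !scalerA.
pose F (w : {ffun 'I_k.+2 -> 'I_r}) (e : {ffun 'I_k.+2 -> bool}) : R[i] :=
  (\prod_j a (w j) * \prod_j f j (e j)) *
  tau (Psi (term w e ord0) (term w e (lift ord0 ord0)) *
       \prod_j term w e (lift ord0 (lift ord0 j))).
move=> D; rewrite -[D - _]/(Psi _ _).
transitivity (\sum_w \sum_e F w e).
  rewrite -(sum_ffun_pair F) !sum_ffun_cons PsiS mulr_suml linear_sum /=.
  apply: eq_bigr => x _; rewrite sum_ffun_cons mulr_suml linear_sum /=.
  apply: eq_bigr => y _.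
  rewrite (bigA_distr_bigA (fun j d =>
    (a d.1 * f (lift ord0 (lift ord0 j)) d.2) *: word_trace d.1 d.2)).
  rewrite mulr_sumr linear_sum /=; apply: eq_bigr => g _.
  rewrite PsiZ -scalerAl linearZ scaler_prod -scalerAr linearZ /= /F.
  rewrite mulrA; congr (_ * tau (_ * _)).
  - rewrite !big_ord_recl [RHS]mulrACA [X in _ = _ * X]mulrACA -big_split /=.
    rewrite !(ffunE, unlift_none, liftK) /= consf0 !mulrA; congr (_ * _); apply: eq_bigr => j _.
    by rewrite !(ffunE, liftK) /= ?(ffunE, liftK).
  - by rewrite !(ffunE, unlift_none, liftK) /= consf0.
  - by apply: eq_bigr => j _; rewrite !(ffunE, liftK) /= ?(ffunE, liftK).
apply: eq_bigr => w _ /=.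
rewrite -sum_copies mulr_sumr; apply: eq_bigr => e _ /=.
rewrite /F -mulrA; congr (_ * (_ * _)).
exact: (tau_centered_pair XG Xcov (fun u : letter (wsize w) => copy (e (tag u)) (letter_of u))).
Qed.

End LinearCombinations.

(** * Cancellations between the two families *)
Section CopySums.
Variables (R : realType) (s r : nat) (words : 'I_r -> seq 'I_s).

Definition sgn (b : bool) : R[i] := if b then -1 else 1.
Definition first_copy (b : bool) : R[i] := if b then 0 else 1.

Section General.
Variables (k : nat) (w : 'I_k -> 'I_r).
Variable V : {set {set posn (wsize words w)}}.
Local Notation blkw := (posn_block (@block_of k (wsize words w))).
Hypotheses (pV : pairing setT V) (iV : no_isolated_block V).

Lemma isolated_linked j : exists2 j', j' != j & linked blkw V j j'.
Proof. by apply: (linked_other_block pV); move/forallP: iV => /(_ j). Qed.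

Lemma block_of_surj j : exists e, @block_of k (wsize words w) e = j.
Proof.
have [j' _ /existsP[p /existsP[p' /and3P[_ /eqP <- _]]]] := isolated_linked j.
by exists p.1.
Qed.

Lemma comps_le_letters :
  (comps (@row_slot (letter (wsize words w))) V +
   comps (col_slot (@next_letter k (wsize words w))) V <= #|letter (wsize words w)|)%N.
Proof.
apply: (euler_no_isolated (@next_letter_inj _ _) block_of_surj (@block_ofE _ _) pV).
by apply/forallP.
Qed.

Lemma comps_lt_letters a b : a != b -> connect (linked blkw V) a b ->
  ~~ preserved [set p | (blkw p == a) || (blkw p == b)] V ->
  (comps (@row_slot (letter (wsize words w))) V +
   comps (col_slot (@next_letter k (wsize words w))) V < #|letter (wsize words w)|)%N.
Proof.
move=> ab cab npr.
apply: (euler_no_isolated_lt (@next_letter_inj _ _) block_of_surj (@block_ofE _ _) pV _ ab cab npr).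
by apply/forallP.
Qed.
End General.

(** Two words that are not isolated are joined to each other.  Hence they use
    the same family, and the product of their signs is 1 for both families. *)
Lemma copy_sum_pair (w : 'I_2 -> 'I_r) (V : {set {set posn (wsize words w)}}) :
  pairing setT V -> no_isolated_block V ->
  copy_sum (fun=> sgn) V = 2%:R * copy_sum (fun=> first_copy) V.
Proof.
move=> pV iV.
have agreeE (e : {ffun 'I_2 -> bool}) : copies_agree e V = (e == [ffun=> e ord0]).
  apply/forallP/eqP => [H|-> j]; last first.
    by apply/forallP => j'; apply/implyP; rewrite !ffunE.
  have [j' j0 lj] := isolated_linked pV iV ord0.
  apply/ffunP => j; rewrite ffunE; have [->//|jn] := eqVneq j ord0.
  have -> : j = j'.
    apply: val_inj; case: j j' jn j0 {lj} => -[|[|?]] // ? [[|[|?]] //= ?] //.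
  by move/forallP/(_ j')/implyP/(_ lj)/eqP: (H ord0).
have sumE (f : bool -> R[i]) : copy_sum (fun=> f) V = f true ^+ 2 + f false ^+ 2.
  rewrite /copy_sum (reindex_onto (fun b : bool => [ffun=> b])
                                  (fun e : {ffun 'I_2 -> bool} => e ord0)).
    rewrite (eq_bigl predT); last by move=> b; rewrite agreeE !ffunE !eqxx.
    by rewrite big_bool /= !big_ord_recl !big_ord0 !ffunE !mulr1 !expr2.
  by move=> e; rewrite agreeE => /eqP.
by rewrite !sumE /sgn /first_copy sqrrN !expr1n expr0n /= add0r mulr1.
Qed.

(** Exchanging the families on the component of the first word preserves the
    admissible choices and changes the sign of the first word but not that of
    the second. *)
Lemma copy_sum_unlinked k (w : 'I_k.+2 -> 'I_r) (f : 'I_k.+2 -> bool -> R[i])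
    (V : {set {set posn (wsize words w)}}) :
  (forall b, f ord0 b = sgn b) -> (forall b, f (lift ord0 ord0) b = sgn b) ->
  (forall j b, f (lift ord0 (lift ord0 j)) b = 1) ->
  ~~ connect (linked (posn_block (@block_of _ (wsize words w))) V) ord0 (lift ord0 ord0) ->
  copy_sum f V = 0.
Proof.
move=> f0 f1 f2 nc.
set e0 := linked _ V in nc *.
pose h (e : {ffun 'I_k.+2 -> bool}) := [ffun j => e j (+) connect e0 ord0 j].
have hK : involutive h.
  by move=> e; apply/ffunP => j; rewrite !ffunE -addbA addbb addbF.
suff S : copy_sum f V = - copy_sum f V.
  have /eqP : copy_sum f V *+ 2 = 0 by rewrite mulr2n {1}S addNr.
  by rewrite mulrn_eq0 => /eqP.
rewrite {1}/copy_sum (reindex_inj (inv_inj hK)) -sumrN; apply: eq_big => e.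
  apply: eq_forallb => j; apply: eq_forallb => j'.
  have [l|//] := boolP (linked _ V j j'); rewrite /= !ffunE.
  have -> : connect e0 ord0 j' = connect e0 ord0 j.
    apply/idP/idP => c; last exact: connect_trans c (connect1 l).
    apply: connect_trans c _; rewrite linked_sym; exact: connect1.
  by rewrite (inj_eq (can_inj (addbK _))).
move=> _; rewrite !big_ord_recl !f0 !f1 !ffunE connect0 (negbTE nc) addbT addbF.
under eq_bigr do rewrite f2.
under [in RHS]eq_bigr do rewrite f2.
by case: (e ord0) => /=; rewrite /sgn ?mulN1r ?mul1r ?opprK.
Qed.
End CopySums.

(** * Asymptotics *)
Local Open Scope classical_set_scope.

Lemma cvg_eq_pos (T : topologicalType) (u v : nat -> T) (l : T) :
  (forall N, (0 < N)%N -> u N = v N) -> u @ \oo --> l -> v @ \oo --> l.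
Proof.
move=> uv; apply: cvg_trans; apply: near_eq_cvg.
by exists 1%N => // N /= /uv.
Qed.

Section Limits.
Variable R : realType.

Lemma cvg_real_complex (u : nat -> R) (l : R) : u @ \oo --> l ->
  (fun N => (u N)%:C : R[i]^o) @ \oo --> (l%:C : R[i]^o).
Proof.
move=> /cvgrPdist_lt ul; apply/cvgrPdist_lt => e e0.
have eR : e = (complex.Re e)%:C by move: e0; case: e => x y; rewrite ltcE /= => /andP[/eqP -> _].
have e1 : 0 < complex.Re e by rewrite -ltcR -eR.
have := ul _ e1; apply: filterS => N /= h.
rewrite -rmorphB /= normc_def /= expr0n /= addr0 sqrtr_sqr eR ltcR.
exact: h.
Qed.

Lemma cvg_finite_sum (I : finType) (P : pred I) (f : I -> nat -> R[i]^o)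
    (l : I -> R[i]^o) :
  (forall i, P i -> f i @ \oo --> l i) ->
  (fun N => \sum_(i | P i) f i N) @ \oo --> (\sum_(i | P i) l i : R[i]^o).
Proof.
move=> h; elim: (index_enum I) => [|i e IH].
  by rewrite big_nil; under eq_fun do rewrite big_nil; apply: cvg_cst.
rewrite big_cons; under eq_fun do rewrite big_cons.
case: (P i) (h i) => [hi|_]; last exact: IH.
exact: (cvgD (hi isT) IH).
Qed.

Variables (M : nat -> nat) (lambda : R).
Hypothesis hM : (fun N : nat => (M N)%:R / N%:R : R) @ \oo --> lambda.

Lemma cvg_inv_nat : (fun N : nat => N%:R^-1 : R) @ \oo --> 0.
Proof. by rewrite -cvg_shiftS; apply: cvg_harmonic. Qed.

Lemma cvg_exp (u : nat -> R) (l : R) n : u @ \oo --> l -> (fun N => u N ^+ n) @ \oo --> l ^+ n.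
Proof.
move=> ul; elim: n => [|n IH].
  by under eq_fun do rewrite expr0; rewrite expr0; apply: cvg_cst.
under eq_fun do rewrite exprS; rewrite exprS; exact: cvgM.
Qed.

(** For N > 0 the expression is (M / N)^b * (1 / N)^(e - (b + f)). *)
Lemma cvg_weight e b f : (b + f <= e)%N ->
  (fun N => N%:R ^- e * (M N)%:R ^+ b * N%:R ^+ f : R) @ \oo -->
  lambda ^+ b * 0 ^+ (e - (b + f)).
Proof.
move=> le.
apply: (@cvg_eq_pos R (fun N => ((M N)%:R / N%:R) ^+ b * (N%:R^-1) ^+ (e - (b + f)))).
  move=> N N1.
  have N0 : (N%:R : R) != 0 by rewrite pnatr_eq0 -lt0n.
  have [k ek] : exists k, e = (b + f + k)%N by exists (e - (b + f))%N; rewrite subnKC.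
  rewrite ek addKn exprMn !exprVn !exprD.
  have : (N%:R : R) ^+ b != 0 by apply: expf_neq0.
  have : (N%:R : R) ^+ f != 0 by apply: expf_neq0.
  have : (N%:R : R) ^+ k != 0 by apply: expf_neq0.
  move: (N%:R ^+ b) (N%:R ^+ f) (N%:R ^+ k) ((M N)%:R ^+ b) => x y z t x0 y0 z0.
  by field; apply/and3P.
by apply: cvgM; apply: cvg_exp => //; exact: cvg_inv_nat.
Qed.

End Limits.

Section Traces.
Variables (R : realType) (s : nat) (Q : ncpoly R s).

Definition mono_words (l : 'I_(size (msupp Q))) : seq 'I_s :=
  fmonom_val (tnth (in_tuple (msupp Q)) l).

Definition mono_coeff (l : 'I_(size (msupp Q))) : R[i] :=
  mcoeff (tnth (in_tuple (msupp Q)) l) Q.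

Variables (A : ncProbSpace R) (N M : nat).
Variables (X : 'I_s + 'I_s -> 'M[A]_(M, N)) (U U' : 'I_s -> 'M[A]_N).
Hypothesis UE : forall k, sum_family U U' k = adjmx (X k) *m X k.

(** Both sides center the same linear combination of traces; in centered_trace
    this is done after summing over the monomials, in word_trace before. *)
Lemma centered_trace_copy b (W : 'I_s -> 'M[A]_N) :
  (forall x, W x = adjmx (X (copy b x)) *m X (copy b x)) ->
  centered_trace Q W = \sum_l mono_coeff l *: word_trace X mono_words l b.
Proof.
move=> WE.
have trE : \tr (ncpoly_eval Q W) = \sum_l mono_coeff l *:
    \tr (wprod X (fun t : 'I_(size (mono_words l)) => copy b (tnth (in_tuple (mono_words l)) t))).
  rewrite /ncpoly_eval big_tnth raddf_sum /=; apply: eq_bigr => l _.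
  rewrite mul_scalar_mx mxtraceZ mulr_algl; congr (_ *: \tr _).
  by rewrite big_tnth; apply: eq_bigr => t _; rewrite WE.
rewrite /centered_trace trE linear_sum scaler_suml -sumrB.
apply: eq_bigr => l _; rewrite /word_trace /ctrace scalerBr scalerA.
by congr (_ - _ *: _); rewrite linearZ.
Qed.

Lemma combE (f : bool -> R[i]) :
  comb X mono_words mono_coeff f =
  f false *: centered_trace Q U + f true *: centered_trace Q U'.
Proof.
rewrite (centered_trace_copy (b := false)); last by move=> x; rewrite -UE.
rewrite (centered_trace_copy (b := true)); last by move=> x; rewrite -UE.
rewrite !scaler_sumr -big_split /=.
transitivity (\sum_l \sum_b (mono_coeff l * f b) *: word_trace X mono_words l b).
  by rewrite /comb pair_bigA.
apply: eq_bigr => l _; rewrite big_bool /= addrC !scalerA.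
by rewrite (mulrC (f false)) (mulrC (f true)).
Qed.
End Traces.
Arguments mono_words {R s} Q l.
Arguments mono_coeff {R s} Q l.

Section MomentLimits.
Variables (R : realType) (q : R) (M : nat -> nat) (lambda : R).
Hypothesis hM : (fun N : nat => (M N)%:R / N%:R : R) @ \oo --> lambda.
Variables (s r : nat) (words : 'I_r -> seq 'I_s) (a : 'I_r -> R[i]).

(** The power of 0 is 1 when the bound of comps_le_letters is attained, and 0
    when it is strict. *)
Definition qlimit k (w : 'I_k -> 'I_r) (V : {set {set posn (wsize words w)}}) : R :=
  q ^+ crossing_count (@posn_rank _ _) V *
  (lambda ^+ comps (@row_slot (letter (wsize words w))) V *
   0 ^+ (#|letter (wsize words w)| -
     (comps (@row_slot (letter (wsize words w))) V +
      comps (col_slot (@next_letter _ (wsize words w))) V))).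

Lemma cvg_qweight k (w : 'I_k -> 'I_r) (V : {set {set posn (wsize words w)}}) :
  pairing [set: posn (wsize words w)]%SET V -> no_isolated_block V ->
  (fun N => (qweight q N (M N) V)%:C : R[i]^o) @ \oo --> ((qlimit V)%:C : R[i]^o).
Proof.
move=> pV iV; apply: cvg_real_complex; apply: cvgMl_tmp.
exact: cvg_weight (comps_le_letters pV iV).
Qed.

Lemma cvg_pairing_sum k (d : forall w : 'I_k -> 'I_r, {set {set posn (wsize words w)}} -> R[i])
  (P : forall w : 'I_k -> 'I_r, pred {set {set posn (wsize words w)}}) :
  (forall (w : 'I_k -> 'I_r) V, P w V ->
     pairing [set: posn (wsize words w)]%SET V /\ no_isolated_block V) ->
  (fun N => \sum_(w : {ffun 'I_k -> 'I_r}) (\prod_j a (w j)) *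
     \sum_(V | P w V) d w V * (qweight q N (M N) V)%:C : R[i]^o) @ \oo -->
  (\sum_(w : {ffun 'I_k -> 'I_r}) (\prod_j a (w j)) *
     \sum_(V | P w V) d w V * (qlimit V)%:C : R[i]^o).
Proof.
move=> h; apply: cvg_finite_sum => w _; apply: cvgMl_tmp.
apply: cvg_finite_sum => V /h[pV iV]; apply: cvgMl_tmp; exact: cvg_qweight.
Qed.

End MomentLimits.

(** * The limits *)
Theorem theorem4p1 (R : realType) (q : R) (hq : -1 <= q <= 1)
  (s : nat) (hs : (1 <= s)%N)
  (A : nat -> ncProbSpace R) (M : nat -> nat) (lambda : R)
  (hlambda : 0 <= lambda)
  (hM : (fun N : nat => (M N)%:R / N%:R : R) @ \oo --> lambda)
  (W Wt : forall N : nat, 'I_s -> 'M[A N]_N)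
  (hW : forall N : nat, (1 <= N)%N ->
    qwishart_orthogonal q (N%:R^-1 *: 1%:M) (1%:M : 'M[R]_(M N))
      (sum_family (W N) (Wt N)))
  (Q : ncpoly R s) (m : nat) :
  let X N := centered_trace Q (W N) in
  let Y N := centered_trace Q (Wt N) in
  let tau N : A N -> R[i]^o := nc_tau (A N) in
  [/\ exists l : R[i]^o, (fun N => tau N (X N ^+ 2)) @ \oo --> l,
      exists l : R[i]^o, (fun N => tau N ((X N + Y N) ^+ m)) @ \oo --> l
    & (fun N => tau N ((X N - Y N) ^+ 2 * (X N + Y N) ^+ m)
                - 2%:R * tau N (X N ^+ 2) * tau N ((X N + Y N) ^+ m))
        @ \oo --> (0 : R[i]^o)].
Proof.
move=> X Y tau.
have gaussian N : (0 < N)%N -> exists Xm : 'I_s + 'I_s -> 'M[A N]_(M N, N),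
    [/\ jointly_qgaussian q (entry_at Xm),
        forall k k' i i' j j', nc_tau (A N) (Xm k i j * Xm k' i' j') =
          ((1%:M : 'M[R]_(M N)) i i' * (N%:R^-1 *: 1%:M : 'M[R]_N) j j'
             * (k == k')%:R)%:C
      & [/\ X N = comb Xm (mono_words Q) (mono_coeff Q) (@first_copy R),
            X N - Y N = comb Xm (mono_words Q) (mono_coeff Q) (@sgn R)
          & X N + Y N = comb Xm (mono_words Q) (mono_coeff Q) (fun=> 1)]].
  move=> /hW [Xm [XG Xcov WE]]; exists Xm; split=> //.
  by rewrite !(combE Q WE) /= !scale1r scale0r addr0 scaleN1r.
have powE (B : pzRingType) (x : B) n : x ^+ n = \prod_(j < n) x.
  by rewrite prodr_const card_ord.
pose form k (f : 'I_k -> bool -> R[i]) N : R[i]^o :=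
  \sum_(w : {ffun 'I_k -> 'I_(size (msupp Q))}) (\prod_j mono_coeff Q (w j)) *
    \sum_(V | pairing [set: posn (wsize (mono_words Q) w)]%SET V && no_isolated_block V)
      (letters_agree V)%:R * copy_sum f V * (qweight q N (M N) V)%:C.
have tauX N : (0 < N)%N -> form 2 (fun=> @first_copy R) N = tau N (X N ^+ 2).
  move=> /gaussian[Xm [XG Xcov [-> _ _]]].
  by rewrite /tau powE (tau_prod_comb XG Xcov).
have tauD N : (0 < N)%N -> tau N ((X N - Y N) ^+ 2) = 2%:R * tau N (X N ^+ 2).
  move=> N0; rewrite -tauX //; have [Xm [XG Xcov [_ -> _]]] := gaussian _ N0.
  rewrite /tau powE (tau_prod_comb XG Xcov) /form mulr_sumr.
  apply: eq_bigr => w _; rewrite mulrCA; congr (_ * _).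
  rewrite mulr_sumr; apply: eq_bigr => V /andP[pV iV].
  by rewrite (copy_sum_pair R pV iV) mulrCA !mulrA.
have tauS N : (0 < N)%N -> form m (fun _ _ => 1) N = tau N ((X N + Y N) ^+ m).
  move=> /gaussian[Xm [XG Xcov [_ _ ->]]].
  by rewrite /tau powE (tau_prod_comb XG Xcov).
have form_cvg k (f : 'I_k -> bool -> R[i]) :
    exists l : R[i]^o, form k f @ \oo --> l.
  eexists; apply: (@cvg_pairing_sum _ q _ _ hM _ _ (mono_words Q) (mono_coeff Q)
    k (fun w V => (letters_agree V)%:R * copy_sum f V)
    (fun w V => pairing [set: posn (wsize (mono_words Q) w)]%SET V
                && no_isolated_block V)).
  by move=> w V /andP[].
split.
- have [l hl] := form_cvg 2 (fun=> @first_copy R).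
  by exists l; apply: cvg_eq_pos tauX hl.
- have [l hl] := form_cvg m (fun _ _ => 1).
  by exists l; apply: cvg_eq_pos tauS hl.
pose f (j : 'I_m.+2) : bool -> R[i] := if (j < 2)%N then @sgn R else fun=> 1.
pose good (w : 'I_m.+2 -> 'I_(size (msupp Q)))
    (V : {set {set posn (wsize (mono_words Q) w)}}) :=
  pairing [set: posn (wsize (mono_words Q) w)]%SET V && (no_isolated_block V &&
    ~~ preserved (first_two_blocks (wsize (mono_words Q) w)) V).
pose rest N : R[i]^o :=
  \sum_(w : {ffun 'I_m.+2 -> 'I_(size (msupp Q))}) (\prod_j mono_coeff Q (w j)) *
    \sum_(V | good w V)
      (letters_agree V)%:R * copy_sum f V * (qweight q N (M N) V)%:C.
(* By tauD the difference is the moment in which the square is centered too. *)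
apply: (@cvg_eq_pos _ rest).
  move=> N N0; rewrite -mulrA mulrA -tauD //.
  have [Xm [XG Xcov [_ -> ->]]] := gaussian _ N0.
  have := tau_centered_comb XG Xcov (mono_words Q) (mono_coeff Q) f.
  rewrite -/(rest N) => <-.
  by rewrite mulrBl linearB /= -scalerAl mul1r linearZ /= !expr2 powE.
pose limit : R[i]^o :=
  \sum_(w : {ffun 'I_m.+2 -> 'I_(size (msupp Q))}) (\prod_j mono_coeff Q (w j)) *
    \sum_(V | good w V)
      (letters_agree V)%:R * copy_sum f V * (qlimit q lambda V)%:C.
have limit0 : limit = 0.
  apply: big1 => w _; rewrite [X in _ * X]big1 ?mulr0 // => V /and3P[pV iV npr].
  (* Either the signs cancel, or a third block is joined to the first two. *)
  have [c|nc] := boolP (connect (linked (posn_block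
      (@block_of _ (wsize (mono_words Q) w))) V) ord0 (lift ord0 ord0)).
    have lt := comps_lt_letters pV iV
      (isT : ord0 != lift ord0 ord0 :> 'I_m.+2) c npr.
    by rewrite /qlimit expr0n subn_eq0 leqNgt lt /= !mulr0.
  by rewrite copy_sum_unlinked // ?mulr0 ?mul0r.
rewrite -limit0.
apply: (@cvg_pairing_sum _ q _ _ hM _ _ (mono_words Q) (mono_coeff Q) m.+2
  (fun w V => (letters_agree V)%:R * copy_sum f V) good).
by move=> w V /and3P[].
Qed.
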